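(* For all non-constant symmetric functions $f:\{0,1\}^N\to\{0,1\}$, $$Q_2(f)=\Theta\left(\max_\mu Q_{WE}^\mu(f)\right)=\Theta\left(\sqrt{N(N-\Gamma(f))}\right),$$ where the maximum ranges over all probability distributions $\mu$ on $\{0,1\}^N$, and the constants implicit in $\Theta$ are absolute (independent of $N$ and $f$).
   Context: Quantum query model. The input $x\in\{0,1\}^N$ is accessed through the unitary $O=O_x$ acting on basis states by $O|i,b,z\rangle=|i,b\oplus x_i,z\rangle$, with $i\in\{1,\dots,N\}$, $b\in\{0,1\}$ and $z$ a workspace of finitely many qubits. A $T$-query quantum algorithm is $A=U_TOU_{T-1}O\cdots U_1OU_0$, with each $U_j$ a fixed unitary independent of $x$; it starts in the all-zero state, and its output is obtained by measuring the rightmost bit of the final state. $P_A(x)$ denotes the probability that $A$ outputs $1$ on input $x$. $Q_2(f)$ is the minimal number of queries $T$ of a quantum algorithm that outputs $f(x)$ with probability at least $\frac23$ for every $x\in\{0,1\}^N$. For a probability distribution $\mu$ on $\{0,1\}^N$, an algorithm $A$ is weakly $\frac23$-exact for $f$ with respect to $\mu$ if $\mu(\{x: P_A(x)=f(x)\})\ge\frac23$. $Q_{WE}^\mu(f)$ is the minimal number of queries of a weakly $\frac23$-exact algorithm for $f$ with respect to $\mu$. $|x|$ denotes the Hamming weight (number of 1's) of $x$. A function $f:\{0,1\}^N\to\{0,1\}$ is symmetric if $f(x)$ depends only on $|x|$; then $f_k$ denotes the value $f(x)$ for $|x|=k$. For non-constant symmetric $f$, $$\Gamma(f)=\min\{|2k-N+1|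 \;:\; f_k\ne f_{k+1},\ 0\le k\le N-1\}.$$ *)

(* Defs.v *)
From mathcomp Require Import all_boot all_order all_algebra.
From mathcomp Require Import spectral reals.
From mathcomp.real_closed Require Import complex.

Set Implicit Arguments.
Unset Strict Implicit.
Unset Printing Implicit Defensive.

Import Order.TTheory GRing.Theory Num.Theory.
Local Open Scope ring_scope.
Local Open Scope complex_scope.

(* Basis states |i, b, z>; the query index i = 1, ..., N is shifted to 'I_N. *)
Definition basis (N m : nat) : finType := ('I_N * bool * m.-tuple bool)%type.

Definition zero_basis N m (s : basis N m) : bool :=
  let: (i, b, z) := s in [&& val i == 0%N, ~~ b & ~~ has id z].

(* The rightmost bit of |i, b, z>: the last bit of z, or b when z is empty. *)
Definition rightmost N m (s : basis N m) : bool :=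
  let: (i, b, z) := s in last b z.

Definition query N m (x : N.-tuple bool) (s : basis N m) : basis N m :=
  let: (i, b, z) := s in (i, b (+) tnth x i, z).

(* Matrices act on column vectors indexed by the enumeration of the basis. *)
Definition oracle (R : realType) N m (x : N.-tuple bool) :
    'M[R[i]]_#|basis N m| :=
  \matrix_(p, q) (enum_val p == query x (enum_val q))%:R.

Definition init_state (R : realType) N m : 'cV[R[i]]_#|basis N m| :=
  \col_p (zero_basis (enum_val p))%:R.

(* Only U_0, ..., U_T are used. *)
Record qalg (R : realType) (N T : nat) := QAlg {
  qubits : nat;
  gate : nat -> 'M[R[i]]_#|basis N qubits|;
  gate_unitary : forall j, gate j \is unitarymx
}.

Section Run.
Variables (R : realType) (N T : nat) (A : qalg R N T) (x : N.-tuple bool).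

(* U_t O U_{t-1} O ... O U_0 *)
Fixpoint run_op (t : nat) : 'M[R[i]]_#|basis N (qubits A)| :=
  if t is t'.+1 then gate A t *m oracle R (qubits A) x *m run_op t'
  else gate A 0.

Definition final_state : 'cV[R[i]]_#|basis N (qubits A)| :=
  run_op T *m init_state R N (qubits A).

Definition prob_output (v : bool) : R :=
  \sum_(p | rightmost (enum_val p) == v)
     (complex.Re (final_state p 0) ^+ 2 + complex.Im (final_state p 0) ^+ 2).

Definition accept_prob : R := prob_output true.

End Run.

Section Complexity.
Variables (R : realType) (N : nat).
Implicit Types (f : N.-tuple bool -> bool) (mu : N.-tuple bool -> R).

Definition is_min (P : nat -> Prop) (n : nat) : Prop :=
  P n /\ forall k, P k -> (n <= k)%N.

Definition bounded_error T (A : qalg R N T) f : Prop :=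
  forall x, 2 / 3 <= prob_output A x (f x).

Definition is_Q2 f (q : nat) : Prop :=
  is_min (fun T => exists A : qalg R N T, bounded_error A f) q.

Definition is_distribution mu : Prop :=
  (forall x, 0 <= mu x) /\ \sum_x mu x = 1.

Definition weakly_exact T (A : qalg R N T) mu f : Prop :=
  2 / 3 <= \sum_(x | accept_prob A x == (f x)%:R) mu x.

Definition is_QWE mu f (q : nat) : Prop :=
  is_min (fun T => exists A : qalg R N T, weakly_exact A mu f) q.

Definition is_max_QWE f (w : nat) : Prop :=
  (exists2 mu, is_distribution mu & is_QWE mu f w) /\
  (forall mu, is_distribution mu -> exists2 q, is_QWE mu f q & (q <= w)%N).

End Complexity.

Section Symmetric.
Variables (N : nat) (f : N.-tuple bool -> bool).

Definition hamming (x : N.-tuple bool) : nat := count id x.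

Definition symmetric_fun : Prop :=
  forall x y, hamming x = hamming y -> f x = f y.

Definition non_constant : Prop := exists x y, f x <> f y.

(* f_k, for k <= N, read off at the input 1^k 0^(N-k). *)
Definition weight_value (k : nat) : bool := f [tuple (i < k)%N | i < N].

(* Every |2k - N + 1| with k < N is smaller than N, so the starting value N
   does not affect the minimum when f is not constant. *)
Definition Gamma : nat :=
  \big[minn/N]_(k < N | weight_value k != weight_value k.+1)
     absz ((2 * k)%:Z - N%:Z + 1).

End Symmetric.

Definition within (R : realType) (c C a b : R) : Prop := c * b <= a <= C * b.

(* Main.v *)
(** Lower bound (Ambainis' adversary method). Let [f_k <> f_(k+1)] and sum the
    real inner products of the states of [x] and [y] over all edges [x < y] of
    the Boolean cube between the weights [k] and [k+1]. The sum starts at the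
    number [E] of edges, and one query changes it by at most
    [2 E / sqrt ((N - k) (k + 1))]. In the end it is at most [17/18 E] for a
    bounded-error algorithm. If [mu] picks a random endpoint of a random edge,
    it is at most [2/3 E] for a weakly exact algorithm, because two inputs
    answered correctly with certainty have orthogonal final states.

    Upper bound. Write [Gamma f + 2 K = N + 1]; then [f] is constant on the
    weights in [[K, N - K]], so it suffices to compute [min (|x|, K)] for [x] and
    for its complement. If a set [S] is promised to contain at most [m] ones,
    then exact Grover search for exactly [j] ones, [j = m, ..., 1], finds all of
    them with certainty: a failed search excludes the count [j]. This costs
    [O(sqrt (|S| m))] queries. Running it with [m = 74 K] on random samples of
    sizes [N / 2^l] costs [O(sqrt (N K))] in total. Every reported one is
    verified, so counts are never overestimated; the full set gives the exact
    count when [|x| < K], and otherwise some sample contains between [K] and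
    [74 K] ones for most seeds. The resulting family of algorithms is exact on
    [x] for at least 2/3 of the seeds. Averaging over the seeds gives a
    bounded-error algorithm; for each [mu], the best seed is weakly exact.

    Algorithms are built on the level of Gram matrices of the states, which
    determine the states up to a unitary that does not depend on the input. *)

From mathcomp Require Import all_boot all_order all_algebra fingroup perm.
From mathcomp Require Import spectral sesquilinear reals boolp.
From mathcomp Require Import topology normedtype derive realfun trigo.
From mathcomp.real_closed Require Import complex.
From mathcomp Require Import ring lra zify.
Require Import Defs.

Set Implicit Arguments.
Unset Strict Implicit.
Unset Printing Implicit Defensive.

Import numFieldNormedType.Exports.
Import Order.TTheory GRing.Theory Num.Theory.
Local Open Scope ring_scope.

(** * Gram matrices of query algorithms *)

Section Gram.
Variables (R : realType) (N : nat).
Local Notation X := (N.-tuple bool).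
Implicit Types (G H : X -> X -> R) (x y : X).

(** Positive semidefiniteness is encoded as a factorization through real vectors, because these
    vectors later become the amplitudes of actual states. *)
Definition psd G := exists (D : finType) (u : X -> D -> R),
  forall x y, G x y = \sum_d u x d * u y d.

Lemma eq_psd G H : (forall x y, G x y = H x y) -> psd G -> psd H.
Proof. by move=> eqGH [D [u Gu]]; exists D, u => x y; rewrite -eqGH. Qed.

Lemma psd_rank1 (u : X -> R) : psd (fun x y => u x * u y).
Proof. by exists unit, (fun x _ => u x) => x y; rewrite (big_pred1 tt) //; case. Qed.

Lemma psd_const (a : R) : 0 <= a -> psd (fun _ _ => a).
Proof.
move=> a0; apply: (eq_psd _ (psd_rank1 (fun=> Num.sqrt a))) => _ _ /=.
by rewrite -expr2 sqr_sqrtr.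
Qed.

Lemma psdD G H : psd G -> psd H -> psd (fun x y => G x y + H x y).
Proof.
move=> [D [u Gu]] [E [v Hv]].
exists (D + E)%type, (fun x d => match d with inl d => u x d | inr e => v x e end).
by move=> x y; rewrite big_sumType /= Gu Hv.
Qed.

Lemma psdM G H : psd G -> psd H -> psd (fun x y => G x y * H x y).
Proof.
move=> [D [u Gu]] [E [v Hv]].
exists (D * E)%type, (fun x d => u x d.1 * v x d.2) => x y.
rewrite Gu Hv big_distrlr /= pair_big /=.
by apply: eq_bigr => p _; rewrite mulrACA.
Qed.

Lemma psd_sum (L : finType) (P : pred L) (A : L -> X -> X -> R) :
  (forall l, psd (A l)) -> psd (fun x y => \sum_(l | P l) A l x y).
Proof.
move=> psdA; elim: (index_enum L) => [|l s IHs].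
  by apply: (eq_psd _ (psd_const (lexx 0))) => x y; rewrite big_nil.
case Pl : (P l).
  by apply: (eq_psd _ (psdD (psdA l) IHs)) => x y; rewrite big_cons Pl.
by apply: (eq_psd _ IHs) => x y; rewrite big_cons Pl.
Qed.

Lemma psd_diag G x : psd G -> 0 <= G x x.
Proof.
by move=> [D [u ->]]; apply: sumr_ge0 => d _; rewrite -expr2 sqr_ge0.
Qed.

Definition phase (i : option 'I_N) x : R :=
  if i is Some j then (-1) ^+ tnth x j else 1.

Lemma phase_sqr i x : phase i x * phase i x = 1.
Proof. by case: i => [j|] /=; rewrite ?mulr1 // -signr_addb addbb. Qed.

(* [G] is the Gram matrix of the states, one for each input, reached by some
   [T]-query algorithm. A query is made in the phase basis: the part of the
   state with query register [i] and target [|->] (Gram matrix [M (Some i)])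
   acquires the sign [(-1)^(x_i)], the part with target [|+>] (Gram matrix
   [M None]) is unchanged; unitaries leave the Gram matrix invariant. *)
Fixpoint reach T G : Prop :=
  if T is T'.+1 then
    exists M : option 'I_N -> X -> X -> R,
      [/\ forall i, psd (M i), reach T' (fun x y => \sum_i M i x y)
        & forall x y, G x y = \sum_i phase i x * phase i y * M i x y]
  else forall x y, G x y = 1.

Lemma eq_reach T G H : (forall x y, G x y = H x y) -> reach T G -> reach T H.
Proof.
case: T => [|T] eqGH /=; first by move=> G1 x y; rewrite -eqGH.
by move=> [M [psdM rM GM]]; exists M; split=> // x y; rewrite -eqGH.
Qed.

Lemma reach_diag T G x : reach T G -> G x x = 1.
Proof.
elim: T G => [|T IHT] G /=; first exact.
move=> [M [_ /IHT M1 ->]]; rewrite -[RHS]M1.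
by apply: eq_bigr => i _; rewrite phase_sqr mul1r.
Qed.

(* Running [B l] after the outcome [l]: the register holding [l] is kept, so the
   Gram matrices of the blocks multiply entrywise. *)
Lemma reach_control (L : finType) T1 T2 (A B : L -> X -> X -> R) :
  (forall l, psd (A l)) -> reach T1 (fun x y => \sum_l A l x y) ->
  (forall l, reach T2 (B l)) ->
  reach (T2 + T1) (fun x y => \sum_l A l x y * B l x y).
Proof.
move=> psdA rA; elim: T2 B => [|T2 IH] B /= rB.
  by apply: eq_reach rA => x y; apply: eq_bigr => l _; rewrite rB mulr1.
have [M MP] := fin_all_exists rB.
exists (fun i x y => \sum_l A l x y * M l i x y); split.
- move=> i; apply: (psd_sum _ (A := fun l x y => A l x y * M l i x y)) => l.
  by apply: psdM => //; case: (MP l).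
- apply: (@eq_reach _ (fun x y => \sum_l A l x y * \sum_i M l i x y)).
    move=> x y; rewrite exchange_big /=.
    by apply: eq_bigr => l _; rewrite big_distrr.
  by apply: IH => l; case: (MP l).
- move=> x y; transitivity
    (\sum_l \sum_i A l x y * (phase i x * phase i y * M l i x y)).
    by apply: eq_bigr => l _; rewrite -big_distrr; case: (MP l) => _ _ <-.
  rewrite exchange_big /=; apply: eq_bigr => i _.
  by rewrite big_distrr /=; apply: eq_bigr => l _; rewrite mulrCA.
Qed.

Definition flip x : X := [tuple ~~ tnth x i | i < N].

(** Complementing the input negates every phase with index [Some i], and in the product of the
    phases of [x] and [y] the two signs cancel. *)
Lemma reach_flip T G : reach T G -> reach T (fun x y => G (flip x) (flip y)).
Proof.
elim: T G => [|T IHT] G /=; first by move=> G1 x y; rewrite G1.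
move=> [M [pM rM GM]]; exists (fun i x y => M i (flip x) (flip y)); split.
- move=> i; have [D [u uM]] := pM i.
  by exists D, (fun x => u (flip x)) => x y; rewrite uM.
- exact: IHT rM.
- move=> x y; rewrite GM; apply: eq_bigr => -[i|] _ //=; congr (_ * _).
  by rewrite !tnth_mktuple -!signr_addb addbN addNb negbK.
Qed.

(* Some [T]-query algorithm ends with a measurement whose outcome [l] always
   satisfies [P x l]; [A l x x] is the probability of [l] on input [x]. *)
Definition outputs T (L : finType) (P : X -> L -> Prop) :=
  exists A : L -> X -> X -> R,
    [/\ forall l, psd (A l), reach T (fun x y => \sum_l A l x y)
      & forall x l, A l x x != 0 -> P x l].

Lemma outputs_const (L : finType) (P : X -> L -> Prop) l0 :
  (forall x, P x l0) -> outputs 0 P.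
Proof.
move=> P0; exists (fun l _ _ => (l == l0)%:R); split.
- by move=> l; apply: psd_const; rewrite ler0n.
- by move=> x y /=; rewrite (bigD1 l0) //= eqxx big1 ?addr0 // => l /negbTE ->.
- by move=> x l; case: (l =P l0) => [->|] //; rewrite eqxx.
Qed.

Lemma outputs_flip T (L : finType) (P : X -> L -> Prop) :
  outputs T P -> outputs T (fun x => P (flip x)).
Proof.
move=> [A [pA rA PA]]; exists (fun l x y => A l (flip x) (flip y)); split.
- move=> l; have [D [u uA]] := pA l.
  by exists D, (fun x => u (flip x)) => x y; rewrite uA.
- exact: (reach_flip rA).
- by move=> x l; apply: PA.
Qed.

Lemma outputs_bind T1 T2 (L1 L2 L3 : finType) (P : X -> L1 -> Prop)
    (Q : L1 -> X -> L2 -> Prop) (g : L1 -> L2 -> L3) (S : X -> L3 -> Prop) :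
  outputs T1 P -> (forall l, outputs T2 (Q l)) ->
  (forall x l m, P x l -> Q l x m -> S x (g l m)) ->
  outputs (T2 + T1) S.
Proof.
move=> [A [pA rA PA]] /fin_all_exists[B BP] PQS.
exists (fun n x y => \sum_(p | g p.1 p.2 == n) A p.1 x y * B p.1 p.2 x y); split.
- move=> n; apply: (psd_sum _ (A := fun p x y => A p.1 x y * B p.1 p.2 x y)) => p.
  by apply: psdM => //; case: (BP p.1).
- apply: (@eq_reach _ (fun x y => \sum_l A l x y * \sum_m B l m x y)).
    move=> x y; under eq_bigr do rewrite big_distrr /=.
    rewrite pair_big /=.
    by rewrite (partition_big (fun p => g p.1 p.2) predT).
  by apply: reach_control => // l; case: (BP l).
- move=> x n; have [/existsP[[l m] /= /andP[/eqP <-]]|noex] :=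
    boolP [exists p, (g p.1 p.2 == n) && (A p.1 x x * B p.1 p.2 x x != 0)].
    rewrite mulf_eq0 negb_or => /andP[/PA Px nB] _.
    by apply: PQS Px _; case: (BP l) => _ _; apply.
  case/eqP; apply: big1 => p gp; apply: contraNeq noex => nz.
  by apply/existsP; exists p; rewrite gp.
Qed.

Lemma outputs_map T (L L' : finType) (P : X -> L -> Prop) (g : L -> L')
    (S : X -> L' -> Prop) :
  outputs T P -> (forall x l, P x l -> S x (g l)) -> outputs T S.
Proof.
move=> oP PS; rewrite -[T]add0n.
apply: (outputs_bind (Q := fun _ _ (_ : unit) => True) (g := fun l _ => g l) oP).
  by move=> l; apply: (outputs_const (l0 := tt)).
by move=> x l _ /PS.
Qed.

End Gram.

(** * Exact Grover search *)

Lemma sin_le_id (R : realType) (a : R) : 0 < a -> sin a <= a.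
Proof.
move=> a0.
have [|c _] := MVT a0 (fun x _ => is_derive_sin x).
  by apply: continuous_subspaceT; exact: continuous_sin.
rewrite sin0 !subr0 => ->.
by apply: ler_piMl (ltW a0) (cos_le1 c).
Qed.

Lemma big_option (V : nmodType) (T : finType) (F : option T -> V) :
  \sum_d F d = F None + \sum_i F (Some i).
Proof. by rewrite ![index_enum _]unlock [@Finite.enum in LHS]unlock /= big_cons big_map. Qed.

Section Grover.
Variables (R : realType) (N : nat).
Local Notation X := (N.-tuple bool).
Variable v : option 'I_N -> R.
Hypothesis v_unit : \sum_d v d ^+ 2 = 1.

(* [gstate t] is the state after [t] Grover iterations; [None] is an idle basis
   state, on which the query acts trivially. *)
Fixpoint gstate t (x : X) (d : option 'I_N) : R :=
  if t is t'.+1 then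
    2 * (\sum_e v e * (phase R e x * gstate t' x e)) * v d
    - phase R d x * gstate t' x d
  else v d.

(** An iteration is a query followed by the reflection [2 v v^T - 1]. The reflection preserves inner
    products because [v] is a unit vector, so the Gram matrix changes as under the query alone. *)
Lemma reach_gstate t :
  reach t (fun x y => \sum_d gstate t x d * gstate t y d).
Proof.
elim: t => [|t IHt] /=; first by move=> _ _; rewrite -v_unit; apply: eq_bigr.
exists (fun d x y => gstate t x d * gstate t y d); split=> //.
  by move=> d; exact: (psd_rank1 (fun x => gstate t x d)).
move=> x y; pose a := \sum_e v e * (phase R e x * gstate t x e).
pose b := \sum_e v e * (phase R e y * gstate t y e).
transitivity (\sum_d (4 * a * b * v d ^+ 2
   - 2 * a * (v d * (phase R d y * gstate t y d))
   - 2 * b * (v d * (phase R d x * gstate t x d))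
   + phase R d x * phase R d y * (gstate t x d * gstate t y d))).
  by apply: eq_bigr => d _; rewrite -/a -/b; ring.
rewrite big_split /= !sumrB -!mulr_sumr -/a -/b v_unit; ring.
Qed.

Definition marked (x : X) (d : option 'I_N) := if d is Some i then tnth x i else false.

Lemma phaseE x d : phase R d x = if marked x d then -1 else 1.
Proof. by case: d => [i|] //=; case: (tnth x i); rewrite ?expr1 ?expr0. Qed.

(* With [sin th] the norm of the marked part of [v], each iteration rotates the
   state by [2 th] in the plane spanned by the two parts of [v]. *)
Lemma gstateE (th : R) x :
  \sum_(d | marked x d) v d ^+ 2 = sin th ^+ 2 -> sin th != 0 -> cos th != 0 ->
  forall t d, gstate t x d =
    (if marked x d then sin ((2 * t + 1)%:R * th) / sin th
     else cos ((2 * t + 1)%:R * th) / cos th) * v d.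
Proof.
move=> wE s0 c0; have wC : \sum_(d | ~~ marked x d) v d ^+ 2 = cos th ^+ 2.
  apply: (@addrI _ (sin th ^+ 2)); rewrite addrC [RHS]addrC cos2Dsin2 -v_unit.
  by rewrite [RHS](bigID (marked x)) /= wE addrC.
elim=> [|t IHt] d /=.
  by rewrite mul1r; case: ifP => _; rewrite divff ?mul1r.
set p := sin _ / _ in IHt; set r := cos _ / _ in IHt.
have -> : \sum_e v e * (phase R e x * gstate t x e)
    = - p * sin th ^+ 2 + r * cos th ^+ 2.
  rewrite (bigID (marked x)) /= -wE -wC !mulr_sumr; congr (_ + _).
    by apply: eq_bigr => e me; rewrite IHt phaseE me; ring.
  by apply: eq_bigr => e /negbTE me; rewrite IHt phaseE me; ring.
rewrite IHt phaseE.
have -> : (2 * t.+1 + 1)%:R * th = (2 * t + 1)%:R * th + th + th.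
  by rewrite !natrD !natrM; ring.
rewrite {IHt}/p /r; set phi := _ * th.
have cs := cos2Dsin2 th.
rewrite -!addrA !(sinD, cosD).
move: (sin phi) (cos phi) (sin th) (cos th) s0 c0 cs => sp cp s c s0 c0 cs.
have c2 : c ^+ 2 = 1 - s ^+ 2 by rewrite -cs addrK.
case: ifP => _.
  transitivity ((2 * (- sp * s + cp * c) + sp / s) * v d); first by field; rewrite s0 c0.
  congr (_ * _); apply: (mulfI s0); rewrite -[RHS]mulrC divfK //.
  transitivity (sp * (1 - 2 * s ^+ 2) + 2 * cp * c * s); first by field.
  have -> : 1 - 2 * s ^+ 2 = c ^+ 2 - s ^+ 2 by rewrite c2; ring.
  ring.
transitivity ((2 * (- sp * s + cp * c) - cp / c) * v d); first by field; rewrite s0 c0.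
congr (_ * _); apply: (mulfI c0); rewrite -[RHS]mulrC divfK //.
transitivity (cp * (c ^+ 2 * 2 - 1) - 2 * sp * s * c); first by field.
have -> : c ^+ 2 * 2 - 1 = c ^+ 2 - s ^+ 2 by rewrite c2; ring.
ring.
Qed.

(* After one more query to the register [d], the outcome [Some i] certifies
   [x_i = 1]. *)
Lemma outputs_verify (T : nat) (P : X -> option 'I_N -> Prop) :
  (forall (x : X) i, v (Some i) != 0 -> tnth x i -> P x (Some i)) ->
  (forall x, P x None \/ forall d, ~~ marked x d -> gstate T x d = 0) ->
  outputs R T.+1 P.
Proof.
move=> PS PN; pose u := gstate T.
have u0 x i : v (Some i) = 0 -> u x (Some i) = 0.
  move=> vi; rewrite /u; elim: (T) => [//|t IH] /=.
  by rewrite vi IH !mulr0 subr0.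
exists (fun l x y => if l is Some i
  then u x (Some i) * (tnth x i)%:R * (u y (Some i) * (tnth y i)%:R)
  else \sum_d u x d * (~~ marked x d)%:R * (u y d * (~~ marked y d)%:R)); split.
- case=> [i|]; first exact: (psd_rank1 (fun x => u x (Some i) * (tnth x i)%:R)).
  apply: (psd_sum _ (A := fun d x y =>
    u x d * (~~ marked x d)%:R * (u y d * (~~ marked y d)%:R))) => d.
  exact: (psd_rank1 (fun x => u x d * (~~ marked x d)%:R)).
(* The verifying query has its target in a computational basis state, an equal superposition of |+>
   and |->. So each amplitude on [Some i] gives half of its Gram matrix to [M (Some i)] and half to
   [M None]. *)
- exists (fun d x y => if d is Some i then u x d * u y d / 2
    else u x d * u y d + \sum_i u x (Some i) * u y (Some i) / 2); split.
  + have p2 : 0 <= 2^-1 :> R by rewrite invr_ge0.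
    case=> [i|].
      by apply: psdM (psd_const _ p2); exact: (psd_rank1 (fun x => u x (Some i))).
    apply: psdD; first exact: (psd_rank1 (fun x => u x None)).
    apply: (psd_sum _ (A := fun i x y => u x (Some i) * u y (Some i) / 2)) => i.
    by apply: psdM (psd_const _ p2); exact: (psd_rank1 (fun x => u x (Some i))).
  + apply: eq_reach (reach_gstate T) => x y.
    rewrite !big_option /= -addrA -big_split /=; congr (_ + _).
    by apply: eq_bigr => i _; rewrite -/u; field.
  + move=> x y; rewrite !big_option /= !mulr1 !mul1r -!addrA -!big_split /=.
    congr (_ + _); apply: eq_bigr => i _.
    by case: (tnth x i); case: (tnth y i); rewrite /= ?expr0 ?expr1; field.
- move=> x [i|].
    have [/u0->|vi] := eqVneq (v (Some i)) 0; first by rewrite !mul0r eqxx.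
    by case: (boolP (tnth x i)) => [xi _|_]; [exact: PS | rewrite !mulr0 eqxx].
  case: (PN x) => // u00; rewrite big1 ?eqxx // => d _.
  case md: (marked x d); first by rewrite /= !mulr0.
  by rewrite /u u00 ?md // !mul0r.
Qed.

End Grover.

Section ExactSearch.
Variables (R : realType) (N : nat).
Local Notation X := (N.-tuple bool).

Definition ones (S : {set 'I_N}) (x : X) : {set 'I_N} := [set i in S | tnth x i].

(* Exact amplitude amplification: the amplitude on [S] is reduced so that the
   marked part of the initial state has norm exactly [sin th] when there are
   [j] marked elements; [T] iterations then rotate by [2 T th] onto the marked
   subspace. *)
Lemma exact_search (S : {set 'I_N}) (j T : nat) :
  (0 < j)%N -> (0 < T)%N -> (4 * #|S| <= j * (2 * T + 1) ^ 2)%N ->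
  outputs R T.+1 (fun (x : X) l =>
    if l is Some i then i \in ones S x else #|ones S x| <> j).
Proof.
move=> j0 T0 le4; set th : R := pi / 2 / (2 * T + 1)%:R.
have d0 : (0 : R) < (2 * T + 1)%:R by rewrite ltr0n addn1.
have d3 : (3 : R) <= (2 * T + 1)%:R by rewrite ler_nat; lia.
have th0 : 0 < th by rewrite divr_gt0 // divr_gt0 ?pi_gt0.
have thpi : th < pi / 2.
  by rewrite /th ltr_pdivrMr // ltr_pMr ?divr_gt0 ?pi_gt0 //; lra.
have s0 : 0 < sin th by apply: sin_gt0_pihalf; rewrite th0.
have c0 : 0 < cos th by apply: cos_gt0_pihalf; rewrite thpi andbT; lra.
have j0R : (0 : R) < j%:R by rewrite ltr0n.
(* This makes the radicand of the idle amplitude [v None] nonnegative. It follows from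
   [sin th <= th] and [pi / 2 <= 2]. *)
have n_s : #|S|%:R * sin th ^+ 2 <= j%:R.
  have le_s : sin th ^+ 2 <= 4 / (2 * T + 1)%:R ^+ 2.
    apply: (@le_trans _ _ (th ^+ 2)).
      rewrite ler_sqr ?nnegrE; [exact: sin_le_id | exact: ltW | exact: ltW].
    rewrite /th expr_div_n ler_pM2r ?invr_gt0 ?exprn_gt0 //.
    by have /andP[? ?] := @pihalf_02 R; nra.
  apply: (le_trans (ler_wpM2l (ler0n _ _) le_s)).
  rewrite mulrA ler_pdivrMr ?exprn_gt0 //.
  by rewrite -natrX -!natrM ler_nat mulnC.
pose v (d : option 'I_N) : R := if d is Some i then (i \in S)%:R * (sin th / Num.sqrt j%:R)
  else Num.sqrt (1 - #|S|%:R * (sin th ^+ 2 / j%:R)).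
have v_sqr i : v (Some i) ^+ 2 = (i \in S)%:R * (sin th ^+ 2 / j%:R).
  rewrite /= exprMn expr_div_n sqr_sqrtr ?ltW //.
  by case: (i \in S); rewrite ?mul0r ?mul1r ?expr0n ?expr1n ?mul0r ?mul1r.
have v1 : \sum_d v d ^+ 2 = 1.
  rewrite big_option /=; under eq_bigr do rewrite v_sqr.
  rewrite sqr_sqrtr; last by rewrite subr_ge0 mulrA ler_pdivrMr // mul1r.
  have -> : #|S|%:R = \sum_i (i \in S)%:R :> R.
    by rewrite -sum1_card natr_sum big_mkcond; apply: eq_bigr => i _; case: (i \in S).
  by rewrite -mulr_suml subrK.
apply: (outputs_verify v1) => [x i|x].
  rewrite /= /ones inE; case: (i \in S) => //=; by rewrite mul0r eqxx.
have [ceq|/eqP cne] := eqVneq #|ones S x| j; [right | by left].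
have wE : \sum_(d | marked x d) v d ^+ 2 = sin th ^+ 2.
  rewrite big_mkcond big_option /= add0r.
  transitivity (\sum_(i in ones S x) (sin th ^+ 2 / j%:R)).
    rewrite [RHS]big_mkcond; apply: eq_bigr => i _; 
    rewrite -[X in if _ then X else _]/(v (Some i) ^+ 2) v_sqr inE.
    by case: (tnth x i); case: (i \in S); rewrite /= ?mul1r ?mul0r.
  by rewrite sumr_const ceq -[LHS]mulr_natr divfK // lt0r_neq0.
move=> d /negbTE md; rewrite (gstateE v1 wE) ?lt0r_neq0 // md.
have -> : (2 * T + 1)%:R * th = pi / 2.
  by rewrite /th mulrC divfK // lt0r_neq0.
by rewrite cos_pihalf !mul0r.
Qed.

End ExactSearch.

(** * Finding all ones *)

Section Identify.
Variables (R : realType) (N : nat).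
Local Notation X := (N.-tuple bool).

(** The successor makes the number of iterations positive and larger than [sqrt (n / j)], as
    [exact_search] requires. *)
Definition search_time (n j : nat) : nat := (Num.truncn (Num.sqrt (n%:R / j%:R : R))).+1.

Lemma search_timeP n j : (0 < j)%N -> (4 * n <= j * (2 * search_time n j + 1) ^ 2)%N.
Proof.
move=> j0; set t := search_time n j.
have j0R : (0 : R) < j%:R by rewrite ltr0n.
have lt_t : Num.sqrt (n%:R / j%:R) < t%:R :> R by rewrite /t /search_time truncnS_gt.
have : (n <= j * t ^ 2)%N.
  rewrite -(ler_nat R) natrM natrX mulrC -ler_pdivrMr //.
  have q0 : (0 : R) <= n%:R / j%:R by rewrite divr_ge0.
  by rewrite -(sqr_sqrtr q0) ler_sqr ?nnegrE ?sqrtr_ge0 ?ler0n // ltW.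
nia.
Qed.

(** The extra query of each search is the verification. The cap [minn m n] keeps the additive terms,
    at most 2 per search, within [2 sqrt (n m)]. *)
Definition identify_time (n m : nat) : nat :=
  \sum_(1 <= j < (minn m n).+1) (search_time n j).+1.

(** The sum telescopes through [1 / sqrt (m + 1) <= 2 (sqrt (m + 1) - sqrt m)]. *)
Lemma sum_inv_sqrt (n m : nat) :
  \sum_(1 <= j < m.+1) Num.sqrt (n%:R / j%:R) <= 2 * (Num.sqrt n%:R * Num.sqrt m%:R) :> R.
Proof.
elim: m => [|m IHm]; first by rewrite big_geq // sqrtr0 !mulr0.
rewrite big_nat_recr //=; apply: (le_trans (lerD IHm (lexx _))).
rewrite sqrtrM ?ler0n // sqrtrV ?ler0n //.
have b0 : (0 : R) < Num.sqrt m.+1%:R by rewrite sqrtr_gt0 ltr0n.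
have b2 : Num.sqrt m.+1%:R ^+ 2 = Num.sqrt m%:R ^+ 2 + 1 :> R.
  by rewrite !sqr_sqrtr ?ler0n // -natr1.
have s0 := sqrtr_ge0 (n%:R : R).
move: (Num.sqrt n%:R) (Num.sqrt m%:R) (Num.sqrt m.+1%:R) b0 b2 s0 => s a b b0 b2 s0.
suff h : 2 * a + b^-1 <= 2 * b by nra.
rewrite -(ler_pM2r b0) mulrDl mulVf ?lt0r_neq0 //; nra.
Qed.

Lemma identify_time_le (n m : nat) :
  (identify_time n m)%:R <= 4 * Num.sqrt (n * m)%:R :> R.
Proof.
set k := minn m n; have km : (k <= m)%N by rewrite geq_minl.
have kn : (k <= n)%N by rewrite geq_minr.
have le_k : k%:R <= Num.sqrt (n * m)%:R :> R.
  rewrite -(ger0_norm (ler0n R k)) -sqrtr_sqr ler_wsqrtr // -natrX ler_nat; nia.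
apply: (@le_trans _ _ (2 * (Num.sqrt n%:R * Num.sqrt k%:R) + 2 * k%:R)).
  apply: le_trans (lerD (sum_inv_sqrt n k) (lexx _)).
  have -> : 2 * k%:R = \sum_(1 <= j < k.+1) 2 :> R.
    by rewrite sumr_const_nat subn1 mulr_natr.
  rewrite -big_split /= natr_sum; apply: ler_sum => j _.
  rewrite /search_time -2!natr1 -addrA lerD2r.
  by rewrite truncn_le // sqrtr_ge0.
have : Num.sqrt n%:R * Num.sqrt k%:R <= Num.sqrt (n * m)%:R :> R.
  by rewrite -sqrtrM ?ler0n // -natrM ler_wsqrtr // ler_nat leq_mul2l km orbT.
lra.
Qed.

(* Searching for [j] marked elements either finds one or refutes that there are
   [j] of them, so with the promise that at most [j] remain, at most [j - 1]
   remain afterwards in either case. *)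
Lemma identify_rec (S : {set 'I_N}) (Pr : X -> Prop) j T :
  outputs R T (fun (x : X) (F : {set 'I_N}) =>
    F \subset ones S x /\ (Pr x -> #|ones S x :\: F| <= j)%N) ->
  outputs R (\sum_(1 <= i < j.+1) (search_time #|S| i).+1 + T) (fun (x : X) (F : {set 'I_N}) =>
    F \subset ones S x /\ (Pr x -> F = ones S x)).
Proof.
elim: j T => [|j IHj] T oT.
  rewrite big_geq //; apply: (outputs_map (g := id) oT) => x F [FS F0].
  split=> // /F0; rewrite leqn0 cards_eq0 setD_eq0 => SF.
  by apply/eqP; rewrite eqEsubset FS.
(* The search for the largest count [j.+1] comes first, so its cost is absorbed into [T] before the
   induction hypothesis is applied. *)
rewrite big_nat_recr //= -addnA; apply: IHj.
apply: (outputs_bind (Q := fun (F : {set 'I_N}) x l =>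
    if l is Some i then i \in ones (S :\: F) x
    else #|ones (S :\: F) x| <> j.+1)
  (g := fun F l => if l is Some i then i |: F else F) oT) => [F|x F [i|] [FS Fj]].
- apply: exact_search => //.
  apply: leq_trans (search_timeP _ (ltn0Sn j)).
  by rewrite leq_mul2l subset_leq_card // subsetDl.
- rewrite !inE => /andP[/andP[iF iS] xi]; split.
    by rewrite subUset sub1set FS inE iS xi.
  move=> /Fj; rewrite (cardsD1 i) !inE iF iS xi /= ltnS.
  congr (_ <= _)%N; apply: eq_card => k; rewrite !inE; by case: (k == i).
- have -> : ones (S :\: F) x = ones S x :\: F.
    by apply/setP => i; rewrite !inE andbA.
  by move=> nj; split=> // /Fj; rewrite leq_eqVlt => /orP[/eqP//|].
Qed.

Lemma identify (S : {set 'I_N}) m :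
  outputs R (identify_time #|S| m) (fun (x : X) (F : {set 'I_N}) =>
    F \subset ones S x /\ (#|ones S x| <= m -> F = ones S x)%N).
Proof.
rewrite -[identify_time _ _]addn0.
apply: identify_rec.
apply: (outputs_const _ (l0 := set0)) => x; split; first by rewrite sub0set.
move=> le_m; rewrite setD0 leq_min le_m subset_leq_card //.
by apply/subsetP => i; rewrite inE => /andP[].
Qed.

(** A set with more than [m] ones does no harm, since everything reported is a verified one. The
    union of the findings is thus useful without knowing which sets satisfy the promise. *)
Lemma identify_all (S : nat -> {set 'I_N}) (n : nat -> nat) m L :
  (forall l, #|S l| = n l) ->
  outputs R (\sum_(l < L) identify_time (n l) m) (fun (x : X) (F : {set 'I_N}) =>
    F \subset ones setT x /\
    forall l, (l < L)%N -> (#|ones (S l) x| <= m)%N -> ones (S l) x \subset F).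
Proof.
move=> Sn; elim: L => [|L IHL].
  rewrite big_ord0; apply: (outputs_const _ (l0 := set0)) => x.
  by rewrite sub0set; split.
rewrite big_ord_recr /= addnC -Sn.
apply: (outputs_bind (g := fun F F' => F :|: F') IHL (fun=> identify (S L) m)).
move=> x F F' [Fx FL] [F'S F'L]; split.
  rewrite subUset Fx (subset_trans F'S) //.
  by apply/subsetP => i; rewrite !inE => /andP[].
move=> l; rewrite ltnS leq_eqVlt => /orP[/eqP->|lL] lm.
  by rewrite F'L // subsetUr.
by rewrite (subset_trans (FL l lL lm)) // subsetUl.
Qed.

End Identify.

(** * Random samples *)

Section Sampling.
Variable N : nat.
Implicit Types (s : {perm 'I_N}) (A B : {set 'I_N}).

(** For a uniformly random permutation [s] this is a uniformly random [n]-subset; a single seed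
    serves all sample sizes. *)
Definition sample s n : {set 'I_N} := [set i | (s i < n)%N].

Lemma card_sample s n : (n <= N)%N -> #|sample s n| = n.
Proof.
move=> nN; have -> : sample s n = s @^-1: [set i : 'I_N | (i < n)%N].
  by apply/setP => i; rewrite !inE.
rewrite card_preimset; last exact: perm_inj.
have wi : injective (widen_ord nN) by move=> a b /(congr1 val) ab; apply: val_inj.
rewrite -[RHS](card_ord n) -(card_imset _ wi).
apply: eq_card => i; rewrite inE; apply/idP/imsetP => [lt_in|[j _ ->]];
  last by rewrite /= ltn_ord.
by exists (Ordinal lt_in) => //; apply: val_inj.
Qed.

Lemma card_pairs B : (#|B| * #|B|.-1 = \sum_(i in B) \sum_(j in B | j != i) 1)%N.
Proof.
rewrite -[LHS]sum_nat_const; apply: eq_bigr => i iB.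
rewrite (cardsD1 i) iB /= -sum1_card; apply: eq_bigl => j.
by rewrite !inE andbC.
Qed.

Lemma sum_sample1 n (i j : 'I_N) :
  (\sum_(s : {perm 'I_N}) (s i < n) = \sum_(s : {perm 'I_N}) (s j < n))%N.
Proof.
rewrite (reindex_inj (mulgI (tperm i j))) /=.
by apply: eq_bigr => s _; rewrite permM tpermL.
Qed.

(** Two transpositions carry [(i, j)] to [(i', j')], and multiplication by them permutes the
    seeds. *)
Lemma sum_sample2 n (i j i' j' : 'I_N) : i != j -> i' != j' ->
  (\sum_(s : {perm 'I_N}) ((s i < n) && (s j < n)) =
   \sum_(s : {perm 'I_N}) ((s i' < n) && (s j' < n)))%N.
Proof.
move=> ij ij'; pose j1 := tperm i i' j.
rewrite (reindex_inj (mulgI (tperm i i' * tperm j1 j')%g)) /=.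
apply: eq_bigr => s _; rewrite !permM tpermL -/j1 tpermL tpermD //.
  by rewrite -[i'](tpermL i i') /j1 (inj_eq perm_inj) eq_sym.
by rewrite eq_sym.
Qed.

(** By symmetry every index is sampled equally often. The common frequency is found by counting with
    the full set, whose intersection with a sample always has [n] elements. *)
Lemma sample_mean A n : (n <= N)%N ->
  (N * \sum_(s : {perm 'I_N}) #|A :&: sample s n| = #|{perm 'I_N}| * (#|A| * n))%N.
Proof.
move=> nN.
have sumE B : (\sum_(s : {perm 'I_N}) #|B :&: sample s n| =
    \sum_(i in B) \sum_(s : {perm 'I_N}) (s i < n))%N.
  rewrite exchange_big /=; apply: eq_bigr => s _.
  rewrite -sum1_card [RHS]big_mkcond [LHS]big_mkcond; apply: eq_bigr => i _.
  by rewrite !inE; case: (i \in B) => //=; case: (_ < _)%N.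
have [->|[i0 _]] := set_0Vmem A.
  by rewrite cards0 !big1 ?muln0 // => s _; rewrite set0I cards0.
have all : (\sum_(s : {perm 'I_N}) n = N * \sum_(s : {perm 'I_N}) (s i0 < n))%N.
  transitivity (\sum_(s : {perm 'I_N}) #|[set: 'I_N] :&: sample s n|)%N.
    by apply: eq_bigr => s _; rewrite setTI card_sample.
  rewrite sumE (eq_bigr (fun=> \sum_(s : {perm 'I_N}) (s i0 < n)))%N; last first.
    by move=> i _; exact: sum_sample1.
  by rewrite sum_nat_const cardsT card_ord.
rewrite sumE (eq_bigr (fun=> \sum_(s : {perm 'I_N}) (s i0 < n)))%N; last first.
  by move=> i _; exact: sum_sample1.
by rewrite sum_nat_const mulnCA -all sum_nat_const mulnCA.
Qed.

(** The same counting shows that a pair is sampled with probability [n (n - 1) / (N (N - 1))], which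
    is at most [(n / N)^2]. *)
Lemma sample_pairs A n : (n <= N)%N ->
  (N * N * \sum_(s : {perm 'I_N}) #|A :&: sample s n| * #|A :&: sample s n|.-1
   <= #|{perm 'I_N}| * ((#|A| * n) * (#|A| * n)))%N.
Proof.
move=> nN.
have sumE B : (\sum_(s : {perm 'I_N}) #|B :&: sample s n| * #|B :&: sample s n|.-1 =
    \sum_(i in B) \sum_(j in B | j != i) \sum_(s : {perm 'I_N}) ((s i < n) && (s j < n)))%N.
  under [RHS]eq_bigr do rewrite exchange_big /=.
  rewrite exchange_big /=; apply: eq_bigr => s _; rewrite card_pairs.
  rewrite [RHS]big_mkcond [LHS]big_mkcond; apply: eq_bigr => i _.
  rewrite !inE; case: (i \in B) => //=; case: (s i < n)%N => /=; last by rewrite big1.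
  rewrite [RHS]big_mkcond [LHS]big_mkcond; apply: eq_bigr => j _.
  by rewrite !inE; case: (j \in B) => //=; case: (_ < _)%N => //=; case: (_ != _).
have [A1|] := leqP #|A| 1.
  rewrite big1 ?muln0 // => s _.
  have := subset_leq_card (subsetIl A (sample s n)); move: #|A :&: _| => c; nia.
case/card_gt1P=> i0 [j0 [_ _ ij0]].
pose d := (\sum_(s : {perm 'I_N}) ((s i0 < n) && (s j0 < n)))%N.
have constE B : (\sum_(s : {perm 'I_N}) #|B :&: sample s n| * #|B :&: sample s n|.-1 =
    #|B| * #|B|.-1 * d)%N.
  rewrite sumE card_pairs big_distrl /=; apply: eq_bigr => i iB; rewrite big_distrl /=.
  by apply: eq_bigr => j /andP[_ ji]; rewrite mul1n; apply: sum_sample2 => //; rewrite eq_sym.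
have all : (#|{perm 'I_N}| * (n * n.-1) = N * N.-1 * d)%N.
  have := constE [set: 'I_N]; rewrite cardsT card_ord => <-.
  rewrite -[LHS]sum_nat_const.
  by apply: eq_bigr => s _; rewrite setTI card_sample.
rewrite constE.
have N2 : (1 < N)%N.
  by have := ltn_ord i0; have := ltn_ord j0; move: ij0; rewrite -val_eqE /=; lia.
move: all; set M := #|{perm 'I_N}|; move: #|A| => t all.
suff : (N.-1 * (N * N * (t * t.-1 * d)) <= N.-1 * (M * (t * n * (t * n))))%N.
  by rewrite leq_pmul2l //; lia.
have -> : (N.-1 * (N * N * (t * t.-1 * d)) = N * (t * t.-1) * (N * N.-1 * d))%N by ring.
rewrite -all.
have -> : (N * (t * t.-1) * (M * (n * n.-1)) = M * n * (t * t.-1) * (N * n.-1))%N by ring.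
have -> : (N.-1 * (M * (t * n * (t * n))) = M * n * (t * t) * (n * N.-1))%N by ring.
by rewrite leq_mul //; [rewrite !leq_mul // leq_pred | nia].
Qed.

(** By the bound on pairs the variance is at most the mean, so Chebyshev's inequality bounds the
    probability of a deviation of [mean / 2] by [4 / mean]. *)
Lemma sample_chebyshev (R : realType) A n : (n <= N)%N -> (0 < N)%N ->
  let mean : R := (#|A| * n)%:R / N%:R in
  0 < mean ->
  #|[set s : {perm 'I_N} | `|#|A :&: sample s n|%:R - mean| >= mean / 2]|%:R * mean
    <= 4 * #|{perm 'I_N}|%:R.
Proof.
move=> nN N0 mean mean0.
have N0R : (0 : R) < N%:R by rewrite ltr0n.
set c := fun s => #|A :&: sample s n|.
set M : R := #|{perm 'I_N}|%:R.
have S1 : \sum_(s : {perm 'I_N}) (c s)%:R = M * mean.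
  apply: (mulfI (lt0r_neq0 N0R)); rewrite -natr_sum -natrM sample_mean // natrM.
  by rewrite /mean -/M; field; rewrite lt0r_neq0.
have S2 : \sum_(s : {perm 'I_N}) (c s * (c s).-1)%:R <= M * mean ^+ 2.
  rewrite -(ler_pM2l (mulr_gt0 N0R N0R)) -natr_sum -!natrM.
  apply: (@le_trans _ _ (#|{perm 'I_N}| * ((#|A| * n) * (#|A| * n)))%:R).
    by rewrite ler_nat; exact: sample_pairs.
  rewrite natrM [X in _ * X]natrM -/M natrM /mean le_eqVlt; apply/orP; left; apply/eqP.
  by field; rewrite lt0r_neq0.
have V : \sum_(s : {perm 'I_N}) ((c s)%:R - mean) ^+ 2 <= M * mean.
  have -> : \sum_(s : {perm 'I_N}) ((c s)%:R - mean) ^+ 2 =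
      \sum_(s : {perm 'I_N}) (c s * (c s).-1)%:R + \sum_(s : {perm 'I_N}) (c s)%:R
      - 2 * mean * \sum_(s : {perm 'I_N}) (c s)%:R + \sum_(s : {perm 'I_N}) mean ^+ 2.
    rewrite mulr_sumr -big_split -sumrB -big_split /=; apply: eq_bigr => s _.
    by case: (c s) => [|k]; rewrite /= ?natrM -?natr1; ring.
  rewrite S1 sumr_const -[X in _ + X]mulr_natl -/M.
  lra.
have mean2 : 0 < mean / 2 by lra.
have : #|[set s : {perm 'I_N} | `|(c s)%:R - mean| >= mean / 2]|%:R * (mean / 2) ^+ 2 <= M * mean.
  apply: le_trans V; rewrite mulr_natl -sumr_const.
  rewrite [leRHS](bigID [pred s | `|(c s)%:R - mean| >= mean / 2]) /=.
  rewrite -[leLHS]addr0; apply: lerD; last by apply: sumr_ge0 => s _; exact: sqr_ge0.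
  under eq_bigl do rewrite inE.
  apply: ler_sum => s le_s; rewrite -(real_normK (num_real ((c s)%:R - mean))).
  by rewrite ler_sqr ?nnegrE // ltW.
move: (#|_|%:R) => b.
have -> : b * (mean / 2) ^+ 2 = (b * mean / 4) * mean by field.
by rewrite ler_pM2r //; lra.
Qed.

(* Halving the sampling rate until a sample of [A] is expected to have between
   [24 K] and [49 K] elements. *)
Lemma sampling (R : realType) A K : (0 < K)%N -> (K <= #|A|)%N ->
  exists2 l, (l < N.+1)%N &
    (5 * #|{perm 'I_N}| <=
     6 * #|[set s : {perm 'I_N} | (K <= #|A :&: sample s (N %/ 2 ^ l)| <= 74 * K)%N]|)%N.
Proof.
move=> K0 KA; have AN : (#|A| <= N)%N by rewrite -[leqRHS]card_ord max_card.
have N0 : (0 < N)%N by apply: leq_trans K0 (leq_trans KA AN).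
(* If [A] is small, the full set, at level 0, works for every seed. *)
have [A24|A24] := ltnP #|A| (24 * K)%N.
  exists 0%N => //; rewrite (_ : [set _ | _] = setT) ?cardsT ?leq_mul //.
  apply/setP => s; rewrite !inE expn0 divn1.
  have -> : sample s N = setT by apply/setP => i; rewrite !inE ltn_ord.
  by rewrite setIT KA (leq_trans (ltnW A24)) // leq_mul2r orbT.
pose P l := (24 * K * N <= #|A| * (N %/ 2 ^ l))%N.
have exP : exists l, P l by exists 0%N; rewrite /P expn0 divn1 leq_mul.
have Pub l : P l -> (l <= N)%N.
  rewrite /P leqNgt => Pl; rewrite leqNgt; apply: contra Pl => lN.
  have lt2 : (N < 2 ^ l)%N by exact: ltn_trans lN (ltn_expl l (ltnSn 1)).
  by rewrite (divn_small lt2) muln0 muln_gt0 muln_gt0 K0 N0.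
case: (ex_maxnP exP Pub) => l Pl lmax; exists l; first by rewrite ltnS Pub.
have nPl : (#|A| * (N %/ 2 ^ l.+1) < 24 * K * N)%N.
  by rewrite ltnNge; apply/negP => /lmax; rewrite ltnn.
set n := (N %/ 2 ^ l)%N in Pl *.
have nN : (n <= N)%N by rewrite leq_div.
(* Rounding costs at most one element per halving. The next level has mean below [24 K], so this one
   has mean at most [48 K + #|A| / N <= 49 K]. *)
have n2 : (n <= 2 * (N %/ 2 ^ l.+1) + 1)%N by rewrite expnSr divnMA -/n; lia.
have ub : (#|A| * n <= 49 * K * N)%N.
  have NK : (N <= K * N)%N by rewrite leq_pmull.
  apply: leq_trans (leq_mul (leqnn _) n2) _; rewrite mulnDr muln1 mulnCA -mulnA.
  move: nPl; rewrite -mulnA; move: (#|A| * _)%N (K * N)%N NK => u w; lia.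
set mean : R := (#|A| * n)%:R / N%:R.
have N0R : (0 : R) < N%:R by rewrite ltr0n.
have mlb : 24 * K%:R <= mean.
  by rewrite ler_pdivlMr // -!natrM ler_nat.
have mub : mean <= 49 * K%:R.
  by rewrite ler_pdivrMr // -!natrM ler_nat.
have K1 : (1 : R) <= K%:R by rewrite ler1n.
have mean0 : 0 < mean by lra.
(* Since the mean is at least 24, at most 4/24 of the seeds are bad. For the others the count lies
   between [mean / 2 >= 12 K] and [3/2 * mean <= 73.5 K], whence the factor 74. *)
have := sample_chebyshev nN N0 mean0; rewrite -/mean.
set bad := [set _ | _]; set good := [set _ | _] => le4.
have cov : (#|{perm 'I_N}| <= #|bad| + #|good|)%N.
  rewrite -cardsT (_ : setT = bad :|: good) ?cardsU ?leq_subr //.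
  apply/setP => s; symmetry; rewrite !inE; have [//|/=] := lerP (mean / 2) `|_|.
  rewrite ltr_norml => /andP[lb ub']; rewrite -!(ler_nat R) natrM.
  by apply/andP; split; lra.
have : (6 * #|bad| <= #|{perm 'I_N}|)%N.
  rewrite -(ler_nat R) natrM; have : (0 : R) <= #|bad|%:R by [].
  by move: le4; move: (#|bad|%:R) (#|{perm 'I_N}|%:R : R) => b M; nra.
by move: cov; move: #|bad| #|good| #|{perm 'I_N}| => a b M; clear; lia.
Qed.

End Sampling.

(** * From Gram matrices to gates *)

Section GramUnitary.
Local Open Scope sesquilinear_scope.
Variable C : numClosedFieldType.

Lemma mulmx_trmxC_eq0 m n (M : 'M[C]_(m, n)) : M *m M ^t* = 0 -> M = 0.
Proof.
move=> M0; apply/matrixP => i j; move/matrixP/(_ i i): M0; rewrite !mxE => /eqP.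
rewrite psumr_eq0 => [/allP/(_ j (mem_index_enum _))|k _]; rewrite !mxE -normCK ?exprn_ge0 //.
by rewrite implyTb expf_eq0 /= normr_eq0 => /eqP.
Qed.

Lemma unitary_trmxC r s d (P : 'M[C]_(r + s, d)) : (r + s = d)%N ->
  P \is unitarymx -> P ^t* *m P = 1%:M.
Proof. by move=> e; subst d => /unitarymxP/mulmx1C. Qed.

Lemma unitary_complete r d (Q : 'M[C]_(r, d)) : Q \is unitarymx ->
  exists W : 'M[C]_(d - r, d), col_mx Q W \is unitarymx.
Proof.
move=> uQ; set V := orthomx Num.conj (mx_of_hermitian (hermitian1mx _)) Q.
have rV : \rank V = (d - r)%N by rewrite rank_ortho mxrank_unitary.
have : exists W : 'M[C]_(\rank V, d), W \is unitarymx /\ W *m Q ^t* = 0.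
  exists (schmidt (row_base V)); split.
    by rewrite schmidt_unitarymx // rank_leq_col.
  have : (schmidt (row_base V) <= V)%MS.
    by rewrite eqmx_schmidt_free ?row_base_free // eq_row_base.
  by move/orthomx1P.
rewrite rV => -[W [uW WQ]]; exists W.
apply/unitarymxP; rewrite tr_col_mx map_row_mx mul_col_row WQ.
rewrite (unitarymxP uQ) (unitarymxP uW).
have -> : Q *m W ^t* = 0 by rewrite -[LHS]trmxCK trmx_mul map_mxM trmxCK WQ trmx0 map_mx0.
by rewrite -scalar_mx_block.
Qed.

(** Equal Gram matrices mean equal linear relations. A row basis of [A] and the corresponding
    combinations of rows of [B] are orthonormalized by the same matrix [L]; completing both results
    to unitaries [P] and [P'] gives [U = P^* P']. *)
Lemma gram_unitary k d (A B : 'M[C]_(k, d)) : A *m A ^t* = B *m B ^t* ->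
  exists2 U : 'M[C]_d, U \is unitarymx & A *m U = B.
Proof.
move=> eqAB; have [D DA] : exists D, row_base A = D *m A.
  by apply/submxP; rewrite eq_row_base.
have [E EA] : exists E, A = E *m row_base A.
  by apply/submxP; rewrite eq_row_base.
set A0 := row_base A in DA EA; pose B0 := D *m B.
(* [1 - E D] annihilates [A], so the rows of [(1 - E D) B] have zero Gram matrix. *)
have BE : B = E *m B0.
  apply/eqP; rewrite -subr_eq0 mulmxA -{1}[B]mul1mx -mulmxBl; apply/eqP.
  apply: mulmx_trmxC_eq0; rewrite trmx_mul map_mxM !mulmxA -(mulmxA _ B) -eqAB.
  by rewrite mulmxA mulmxBl mul1mx -(mulmxA E) -DA -EA subrr !mul0mx.
have G0 : A0 *m A0 ^t* = B0 *m B0 ^t*.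
  by rewrite DA /B0 !trmx_mul !map_mxM !mulmxA -(mulmxA _ A) eqAB !mulmxA.
have rd : (\rank A <= d)%N by rewrite rank_leq_col.
pose Q := schmidt A0; have uQ : Q \is unitarymx by exact: schmidt_unitarymx.
have [L LQ] : exists L, A0 = L *m Q by apply/submxP; exact: schmidt_sub.
have uL : L \in unitmx.
  rewrite -row_full_unit -col_leq_rank.
  have := mxrankM_maxl L Q; rewrite -LQ; apply: leq_trans.
  by rewrite (eqP (row_base_free A)).
pose Q' := invmx L *m B0.
have uQ' : Q' \is unitarymx.
  apply/unitarymxP; rewrite /Q' trmx_mul map_mxM mulmxA -(mulmxA _ B0) -G0 mulmxA.
  rewrite -(mulmxA _ _ (_ ^t*)) -map_mxM -trmx_mul {1}LQ.
  by rewrite LQ mulKmx //; exact/unitarymxP.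
have [W uP] := unitary_complete uQ; have [W' uP'] := unitary_complete uQ'.
have rsd : (\rank A + (d - \rank A) = d)%N by rewrite subnKC.
exists ((col_mx Q W) ^t* *m col_mx Q' W').
  apply/unitarymxP; rewrite trmx_mul map_mxM trmxCK mulmxA -(mulmxA _ (col_mx Q' W')).
  by rewrite (unitarymxP uP') mulmx1 (unitary_trmxC rsd uP).
have : col_mx Q W *m (col_mx Q W) ^t* *m col_mx Q' W' = col_mx Q' W'.
  by rewrite (unitarymxP uP) mul1mx.
rewrite -mulmxA mul_col_mx => /eq_col_mx[QU _].
by rewrite {1}EA LQ -!mulmxA QU /Q' mulKVmx // -BE.
Qed.

End GramUnitary.

(** * Realizing reachable Gram matrices by query algorithms *)

Section States.
Local Open Scope complex_scope.
Local Open Scope sesquilinear_scope.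
Variables (R : realType) (N : nat).
Hypothesis N_gt0 : (0 < N)%N.
Local Notation X := (N.-tuple bool).
Let i0 : 'I_N := Ordinal N_gt0.

Lemma psd_embed G : @psd R N G -> exists k, forall (E : finType) (P : pred E),
  (k <= #|P|)%N -> exists w : X -> E -> R,
    (forall x e, ~~ P e -> w x e = 0) /\
    (forall x y, G x y = \sum_e w x e * w y e).
Proof.
move=> [D [u Gu]]; exists #|D| => E P le_DP.
pose c d : E := enum_val (widen_ord le_DP (enum_rank d)).
have cI : injective c.
  by move=> a b /enum_val_inj/(congr1 val) /= ab; apply: enum_rank_inj; apply: val_inj.
exists (fun x e => \sum_(d | c d == e) u x d); split=> [x e nPe|x y].
  by apply: big1 => d /eqP cd; case/negP: nPe; rewrite -cd;
  exact: (enum_valP (widen_ord le_DP (enum_rank d))).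
rewrite Gu; transitivity (\sum_e \sum_(d | c d == e) u x d * u y d).
  by rewrite (partition_big c predT).
apply: eq_bigr => e _; rewrite big_distrl; apply: eq_bigr => d /eqP cd /=.
by rewrite (big_pred1 d) // => d' /=; rewrite -cd (inj_eq cI).
Qed.

Lemma sum_basis m (F : basis N m -> R) :
  \sum_(p < #|basis N m|) F (enum_val p) = \sum_s F s.
Proof. by rewrite -big_enum_val. Qed.

Definition ket m (v : basis N m -> R) : 'cV[R[i]]_#|basis N m| :=
  \col_p (v (enum_val p))%:C.

Lemma ket_unitary m (u v : X -> basis N m -> R) :
  (forall x y, \sum_s u x s * u y s = \sum_s v x s * v y s) ->
  exists2 U : 'M[R[i]]_#|basis N m|, U \is unitarymx &
    forall x, U *m ket (u x) = ket (v x).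
Proof.
move=> eqG; pose mat (w : X -> basis N m -> R) : 'M[R[i]]_(#|{: X}|, #|basis N m|) :=
  \matrix_(a, p) (w (enum_val a) (enum_val p))%:C.
have matE w : mat w *m (mat w) ^t* =
    \matrix_(a, b) (\sum_s w (enum_val a) s * w (enum_val b) s)%:C.
  apply/matrixP => a b; rewrite !mxE -sum_basis rmorph_sum /=.
  by apply: eq_bigr => p _; rewrite !mxE /= conj_Creal ?rmorphM // complex_real.
have [U uU UE] : exists2 U : 'M_#|basis N m|, U \is unitarymx & mat u *m U = mat v.
  by apply: gram_unitary; rewrite !matE; apply/matrixP => a b; rewrite !mxE eqG.
exists U^T; first by rewrite trmx_unitary.
have ketE w x : ket (w x) = (row (enum_rank x) (mat w))^T.
  by apply/colP => p; rewrite !mxE enum_rankK.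
by move=> x; rewrite !ketE -trmx_mul -row_mul UE.
Qed.

Lemma queryK m x : involutive (@query N m x).
Proof. by move=> [[i b] z] /=; rewrite addbK. Qed.

Lemma oracleE m x (u : 'cV[R[i]]_#|basis N m|) p :
  (oracle R m x *m u) p 0 = u (enum_rank (query x (enum_val p))) 0.
Proof.
rewrite mxE (bigD1 (enum_rank (query x (enum_val p)))) //=.
rewrite !mxE !enum_rankK queryK eqxx mul1r big1 ?addr0 // => q ne.
rewrite !mxE; case: eqP => [eq|_]; last by rewrite mul0r.
by case/eqP: ne; rewrite eq queryK enum_valK.
Qed.

Lemma oracle_ket m x (v : basis N m -> R) :
  oracle R m x *m ket v = ket (fun s => v (query x s)).
Proof. by apply/colP => p; rewrite oracleE !mxE enum_rankK. Qed.

Definition zero_ket m (s : basis N m) : R := (zero_basis s)%:R.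

Lemma init_stateE m : init_state R N m = ket (@zero_ket m).
Proof. by apply/colP => p; rewrite !mxE /zero_ket; case: (zero_basis _). Qed.

Lemma zero_ket_norm m : \sum_s @zero_ket m s * zero_ket s = 1.
Proof.
rewrite (bigD1 (i0, false, [tuple of nseq m false])) //= big1 => [|[[i b] z] ns].
  by rewrite /zero_ket /= has_nseq andbF /= mulr1 addr0.
rewrite /zero_ket; case: (boolP (zero_basis _)) => [/and3P[/eqP i00 nb nz]|_]; last exact: mulr0.
case/eqP: ns; congr (_, _, _); [exact: val_inj | exact: negbTE | apply: val_inj => /=].
transitivity (nseq (size z) false); last by rewrite size_tuple.
apply/all_pred1P; move: nz; rewrite -all_predC.
by apply: sub_all => c /=; case: c.
Qed.

(** The product of [run_op] for a bare gate sequence, so that single gates can be replaced before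
    unitarity is packaged. *)
Fixpoint run m (g : nat -> 'M[R[i]]_#|basis N m|) (x : X) t : 'M[R[i]]_#|basis N m| :=
  if t is t'.+1 then g t *m oracle R m x *m run g x t' else g 0.

Lemma eq_run m (g h : nat -> 'M[R[i]]_#|basis N m|) x t :
  (forall j, (j <= t)%N -> g j = h j) -> run g x t = run h x t.
Proof.
elim: t => [|t IHt] gh /=; first exact: gh.
by rewrite gh // IHt // => j jt; apply: gh; rewrite ltnW.
Qed.

Lemma reach_run T G : reach T G -> exists m0, forall m, (m0 <= m)%N ->
  forall v : X -> basis N m -> R, (forall x y, G x y = \sum_s v x s * v y s) ->
  exists2 g : nat -> 'M[R[i]]_#|basis N m|, (forall j, g j \is unitarymx) &
    forall x, run g x T *m init_state R N m = ket (v x).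
Proof.
elim: T G => [|T IHT] G /=.
  move=> G1; exists 0%N => m _ v Gv.
  have [x y|U uU UE] := @ket_unitary m (fun=> @zero_ket m) v.
    by rewrite zero_ket_norm -Gv G1.
  by exists (fun=> U) => // x; rewrite init_stateE.
move=> [M [pM /IHT[m0 {}IHT] GM]].
have /fin_all_exists[k kP] := fun i => psd_embed (pM i).
exists (maxn m0 (\sum_i k i)) => m; rewrite geq_max => /andP[m0m km] v Gv.
have w_ex i : exists w : X -> m.-tuple bool -> R,
    forall x y, M i x y = \sum_e w x e * w y e.
  have [|w [_ wE]] := kP i (m.-tuple bool : finType) predT; last by exists w.
  rewrite card_tuple card_bool; apply: leq_trans (ltnW (ltn_expl m (ltnSn 1))).
  by apply: leq_trans km; rewrite (bigD1 i) //= leq_addr.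
have {w_ex} [w wE] := fin_all_exists w_ex.
pose h : R := (Num.sqrt 2)^-1.
have h2 : h * h = 2^-1 by rewrite -invfM -expr2 sqr_sqrtr.
(* The state just before ([c = false]) and after ([c = true]) the last query:
   [M (Some i)] sits on index [i] with target [|->], [M None] on index [i0] with
   target [|+>]. *)
pose phi c x (s : basis N m) : R := let: (i, b, z) := s in
  h * ((if c then phase R (Some i) x else 1) * (-1) ^+ b * w (Some i) x z
       + (i == i0)%:R * w None x z).
(* The cross terms between |-> and |+> cancel in the sum over [b]. *)
have gram c x y : \sum_s phi c x s * phi c y s =
    \sum_i (if c then phase R i x * phase R i y else 1) * M i x y.
  transitivity (\sum_i \sum_b \sum_z phi c x (i, b, z) * phi c y (i, b, z)).
    by rewrite pair_bigA pair_bigA /=; apply: eq_bigr => -[[i b] z].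
  pose p (i : 'I_N) (z : X) : R := if c then phase R (Some i) z else 1.
  transitivity (\sum_i (p i x * p i y * M (Some i) x y + (i == i0)%:R * M None x y)).
    apply: eq_bigr => i _; rewrite big_bool /= -big_split /= !wE !mulr_sumr -big_split /=.
    apply: eq_bigr => z _; rewrite expr1 expr0 -/(p i x) -/(p i y).
    move: (p i x) (p i y) (w (Some i) x z) (w (Some i) y z) => a b d e.
    move: (w None x z) (w None y z) => k1 k2.
    transitivity
      ((h * h) * 2 * (a * b * (d * e) + (i == i0)%:R * (i == i0)%:R * (k1 * k2))).
      by ring.
    rewrite h2 mulVf ?mul1r; last by rewrite pnatr_eq0.
    by case: (i == i0); rewrite ?mul1r ?mul0r.
  rewrite big_split /= addrC big_option /=; congr (_ + _).
    rewrite (bigD1 i0) // eqxx mul1r big1 ?addr0 => [|i /negbTE->]; last by rewrite mul0r.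
    by case: (c); rewrite ?mulr1 !mul1r /= addr0.
  by apply: eq_bigr => i _; rewrite /p; case: (c); rewrite ?mul1r.
have [x y|g ug gE] := IHT m m0m (phi false) _.
  by rewrite gram; apply: eq_bigr => i _; rewrite mul1r.
have [U uU UE] : exists2 U : 'M[R[i]]_#|basis N m|, U \is unitarymx &
    forall x, U *m ket (phi true x) = ket (v x).
  by apply: ket_unitary => x y; rewrite gram -Gv GM.
exists (fun j => if j == T.+1 then U else g j) => [j|x].
  by case: (j == T.+1); [exact: uU | exact: ug].
rewrite /= eqxx (@eq_run m _ g) => [|j jT]; last by rewrite ltn_eqF.
rewrite -mulmxA gE -mulmxA oracle_ket -UE; congr (_ *m _).
apply/colP => p; rewrite !mxE; congr (_%:C); case: (enum_val p) => [[i b] z] /=.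
by rewrite signr_addb (mulrC (_ ^+ b)) mul1r.
Qed.

Lemma reach_qalg T (A : bool -> X -> X -> R) :
  (forall b, psd (A b)) -> reach T (fun x y => \sum_b A b x y) ->
  exists Q : qalg R N T, forall x b, prob_output Q x b = A b x x.
Proof.
move=> pA /reach_run[m0 run_ex].
have /fin_all_exists[k kP] := fun b => psd_embed (pA b).
(* The additional qubit holds the output bit; the other [n] leave enough room for the vectors of
   either outcome. *)
set n := maxn m0 (\sum_b k b); pose m := n.+1.
have w_ex b : exists w : X -> basis N m -> R,
    (forall x s, rightmost s != b -> w x s = 0) /\
    (forall x y, A b x y = \sum_s w x s * w y s).
  have [|w [w0 wE]] := kP b (basis N m) [pred s | rightmost s == b]; last by exists w.
  apply: (@leq_trans #|{: n.-tuple bool}|).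
    rewrite card_tuple card_bool; apply: leq_trans (ltnW (ltn_expl n (ltnSn 1))).
    by apply: leq_trans (leq_maxr _ _); rewrite (bigD1 b) //= leq_addr.
  pose e (z : n.-tuple bool) : basis N m := (i0, false, [tuple of rcons z b]).
  have eI : injective e.
    by move=> z z' [] /(congr1 (@rev bool)); rewrite !rev_rcons => -[] /(can_inj revK)/val_inj.
  rewrite -(card_imset _ eI); apply: subset_leq_card; apply/subsetP => _ /imsetP[z _ ->].
  by rewrite inE /= last_rcons.
have {w_ex} [w wP] := fin_all_exists w_ex.
pose v x s := w (rightmost s) x s.
have vE x y b : \sum_(s | rightmost s == b) v x s * v y s = A b x y.
  case: (wP b) => w0 ->; rewrite [RHS](bigID (fun s => rightmost s == b)) /=.
  rewrite [X in _ = _ + X]big1 ?addr0.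
    by apply: eq_bigr => s /eqP sb; rewrite /v sb.
  by move=> s nb; rewrite w0 ?mul0r.
have [|x y|g ug gE] := run_ex m _ v.
- by rewrite /m leqW // leq_maxl.
- by rewrite (partition_big (@rightmost N m) predT) //; apply: eq_bigr => b _; rewrite vE.
exists (QAlg T ug) => x b.
have fE : final_state (QAlg T ug) x = ket (v x).
  rewrite -gE /final_state; congr (_ *m _).
  by elim: (T) => [|t IH] //=; rewrite -IH.
rewrite /prob_output fE -vE big_mkcond [RHS]big_mkcond -sum_basis /=.
by apply: eq_bigr => p _; rewrite mxE /= expr0n addr0 expr2.
Qed.

End States.

(** * The adversary bound *)

Lemma amgm (R : realFieldType) (c a b : R) :
  0 < c -> a * b <= (c * a ^+ 2 + c^-1 * b ^+ 2) / 2.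
Proof.
move=> c0; have ci : c^-1 * c = 1 by rewrite mulVf ?lt0r_neq0.
have -> : (c * a ^+ 2 + c^-1 * b ^+ 2) / 2 = a * b + c^-1 * (c * a - b) ^+ 2 / 2.
  by rewrite -[X in X * a ^+ 2]mul1r -ci; field; rewrite lt0r_neq0.
by rewrite lerDl divr_ge0 // mulr_ge0 ?sqr_ge0 // invr_ge0 ltW.
Qed.

(** Only [P] contributes, since [sg] fixes its complement. Both products are bounded by the weighted
    AM-GM inequality, and [sg] permutes [P], so it preserves the sum of the squares of [b]. *)
Lemma inner_sub_involution (R : realFieldType) (E : finType) (P : pred E) (sg : E -> E)
    (a b : E -> R) c :
  involutive sg -> (forall e, P (sg e) = P e) -> (forall e, ~~ P e -> sg e = e) -> 0 < c ->
  \sum_e a e * b e - \sum_e a e * b (sg e)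
    <= c * \sum_(e | P e) a e ^+ 2 + c^-1 * \sum_(e | P e) b e ^+ 2.
Proof.
move=> sgK sgP sgE c0.
rewrite -sumrB (bigID P) /= [X in _ + X]big1 ?addr0; last first.
  by move=> e ne; rewrite sgE // subrr.
have bS : \sum_(e | P e) b e ^+ 2 = \sum_(e | P e) b (sg e) ^+ 2.
  by rewrite (reindex_inj (inv_inj sgK)); apply: eq_bigl.
apply: (@le_trans _ _ (\sum_(e | P e) (c * a e ^+ 2 + c^-1 * (b e ^+ 2 + b (sg e) ^+ 2) / 2))).
  apply: ler_sum => e _; have h1 := amgm (a e) (b e) c0.
  have := amgm (a e) (- b (sg e)) c0; rewrite sqrrN mulrN; lra.
rewrite big_split /= -mulr_suml -!mulr_sumr big_split /= -bS.
have c1 : 0 < c^-1 by rewrite invr_gt0.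
by rewrite lerD2l; lra.
Qed.

Section Edges.
Variable N : nat.
Local Notation X := (N.-tuple bool).

Definition toggle (i : 'I_N) (x : X) : X := [tuple tnth x j (+) (j == i) | j < N].

Lemma toggleK i : involutive (toggle i).
Proof. by move=> x; apply: eq_from_tnth => j; rewrite !tnth_mktuple addbK. Qed.

Lemma hammingE (x : X) : hamming x = (\sum_i tnth x i)%N.
Proof.
by rewrite /hamming -sum1_count big_mkcond big_tuple; apply: eq_bigr => i _; case: (tnth x i).
Qed.

Lemma hamming_toggle i x : ~~ tnth x i -> hamming (toggle i x) = (hamming x).+1.
Proof.
move=> xi; rewrite !hammingE (bigD1 i) //= [in RHS](bigD1 i) //=.
rewrite tnth_mktuple eqxx (negbTE xi) /= add1n add0n; congr _.+1.
by apply: eq_bigr => j /negbTE ji; rewrite tnth_mktuple ji addbF.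
Qed.

(* [(x, i)] stands for the edge of the Boolean cube from [x], of weight [k], to
   [toggle i x], of weight [k + 1]. *)
Definition edge k (p : X * 'I_N) := (hamming p.1 == k) && ~~ tnth p.1 p.2.

Definition slice k : {set X} := [set x | hamming x == k].

Lemma edge_toggle k i x :
  edge k (toggle i x, i) = (hamming x == k.+1) && tnth x i.
Proof.
rewrite /edge /= tnth_mktuple eqxx addbT negbK; case xi: (tnth x i); rewrite ?andbF ?andbT //.
have := @hamming_toggle i (toggle i x).
by rewrite toggleK tnth_mktuple eqxx xi => ->; rewrite ?eqSS.
Qed.

Lemma big_slice (V : Type) (idx : V) (op : Monoid.com_law idx) k
    (P : X -> 'I_N -> bool) (F : X -> 'I_N -> V) :
  \big[op/idx]_(p : X * 'I_N | (hamming p.1 == k) && P p.1 p.2) F p.1 p.2 =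
  \big[op/idx]_(x in slice k) \big[op/idx]_(i | P x i) F x i.
Proof. by rewrite pair_big_dep; apply: eq_bigl => p; rewrite inE. Qed.

Lemma card_edge k : #|edge k| = (#|slice k| * (N - k))%N.
Proof.
transitivity (\sum_(x in slice k) \sum_(i | ~~ tnth x i) 1)%N.
  by rewrite -sum1_card; exact: (big_slice _ k (fun x i => ~~ tnth x i) (fun _ _ => 1%N)).
rewrite -sum_nat_const; apply: eq_bigr => x; rewrite inE => /eqP <-.
have -> : hamming x = #|[pred i | tnth x i]|.
  by rewrite hammingE -sum1_card [RHS]big_mkcond.
by rewrite -[X in (X - _)%N](card_ord N) -(cardC [pred i | tnth x i]) addKn -sum1_card.
Qed.

Lemma card_edgeS k : #|edge k| = (#|slice k.+1| * k.+1)%N.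
Proof.
pose tau (p : X * 'I_N) := (toggle p.2 p.1, p.2).
have tauK : involutive tau by move=> [x i]; rewrite /tau /= toggleK.
rewrite -[LHS]sum1_card (reindex_inj (inv_inj tauK)) /=.
rewrite (eq_bigl (fun p => (hamming p.1 == k.+1) && tnth p.1 p.2)); last first.
  by move=> [x i]; rewrite -edge_toggle.
transitivity (\sum_(x in slice k.+1) \sum_(i | tnth x i) 1)%N.
  exact: (big_slice _ k.+1 (fun x i => tnth x i) (fun _ _ => 1%N)).
rewrite -sum_nat_const.
by apply: eq_bigr => x; rewrite inE => /eqP <-; rewrite hammingE big_mkcond.
Qed.

(** Here [w x i] stands for the query weight of [x] at index [i]. The edges at one vertex have
    distinct indices, so each vertex contributes at most 1. *)
Lemma slice_sum_le (R : realFieldType) k (P : X -> 'I_N -> bool) (w : X -> 'I_N -> R) :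
  (forall x i, 0 <= w x i) -> (forall x, \sum_i w x i <= 1) ->
  \sum_(p : X * 'I_N | (hamming p.1 == k) && P p.1 p.2) w p.1 p.2 <= #|slice k|%:R.
Proof.
move=> w0 w1; have -> := big_slice _ k P w.
rewrite -sum1_card natr_sum; apply: ler_sum => x _; apply: le_trans (w1 x).
by rewrite [leRHS](bigID (P x)) /= lerDl; apply: sumr_ge0.
Qed.

Lemma edge_sum_le (R : realFieldType) k (w : X -> 'I_N -> R) (c d : R) :
  (forall x i, 0 <= w x i) -> (forall x, \sum_i w x i <= 1) -> 0 <= c -> 0 <= d ->
  \sum_(p | edge k p) (c * w p.1 p.2 + d * w (toggle p.2 p.1) p.2)
    <= c * #|slice k|%:R + d * #|slice k.+1|%:R.
Proof.
move=> w0 w1 c0 d0; rewrite big_split -!mulr_sumr /=.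
apply: lerD; apply: ler_wpM2l => //.
  exact: (slice_sum_le k (fun x i => ~~ tnth x i) w0 w1).
pose tau (p : X * 'I_N) := (toggle p.2 p.1, p.2).
have tauK : involutive tau by move=> [x i]; rewrite /tau /= toggleK.
rewrite (reindex_inj (inv_inj tauK)) /=.
rewrite (eq_bigl (fun p => (hamming p.1 == k.+1) && tnth p.1 p.2)); last first.
  by move=> [x i]; rewrite -edge_toggle.
under eq_bigr do rewrite toggleK.
exact: (slice_sum_le k.+1 (fun x i => tnth x i) w0 w1).
Qed.

End Edges.

Section Adversary.
Variables (R : realType) (N T : nat) (Q : qalg R N T).
Local Notation X := (N.-tuple bool).
Local Notation E := (basis N (qubits Q) * bool)%type.
Local Notation C := R[i].

Definition state t (x : X) := run_op Q x t *m init_state R N (qubits Q).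

(** The flag [e.2] selects the real or imaginary part. States become real vectors, and [ip] is the
    real part of the complex inner product. *)
Definition amp t (x : X) (e : E) : R :=
  let z := state t x (enum_rank e.1) 0 in if e.2 then complex.Re z else complex.Im z.

Definition ip t x y : R := \sum_e amp t x e * amp t y e.

Definition query_amp x (e : E) : E := (query x e.1, e.2).

Lemma query_ampK x : involutive (query_amp x).
Proof. by move=> [[[i b] z] c]; rewrite /query_amp /= addbK. Qed.

Lemma sum_E (G : E -> R) :
  \sum_e G e = \sum_(p < #|basis N (qubits Q)|) (G (enum_val p, true) + G (enum_val p, false)).
Proof.
transitivity (\sum_s \sum_c G (s, c)); first by rewrite pair_bigA; apply: eq_bigr => -[].
by rewrite -sum_basis; apply: eq_bigr => p _; rewrite big_bool.
Qed.

Local Open Scope sesquilinear_scope.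

Lemma gate_ip m (U : 'M[C]_m) (u v : 'cV[C]_m) : U \is unitarymx ->
  \sum_p (complex.Re ((U *m u) p 0) * complex.Re ((U *m v) p 0)
    + complex.Im ((U *m u) p 0) * complex.Im ((U *m v) p 0))
  = \sum_p (complex.Re (u p 0) * complex.Re (v p 0)
    + complex.Im (u p 0) * complex.Im (v p 0)).
Proof.
have ipE (a b : 'cV[C]_m) :
    \sum_p (complex.Re (a p 0) * complex.Re (b p 0) + complex.Im (a p 0) * complex.Im (b p 0))
    = complex.Re ((a ^t* *m b) 0 0).
  rewrite mxE raddf_sum; apply: eq_bigr => p _; rewrite !mxE.
  by case: (a p 0) (b p 0) => [ar ai] [br bi] /=; rewrite mulNr opprK.
move=> /unitarymxP/mulmx1C uU.
by rewrite !ipE trmx_mul map_mxM -mulmxA (mulmxA _ U) uU mul1mx.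
Qed.

Lemma ip0 x y : (0 < N)%N -> ip 0 x y = 1.
Proof.
move=> N0; rewrite /ip sum_E /amp /=; under eq_bigr do rewrite !enum_valK.
rewrite /state /= gate_ip ?gate_unitary // -(zero_ket_norm R N0 (qubits Q)) -sum_basis.
by apply: eq_bigr => p _; rewrite init_stateE !mxE /= mulr0 addr0.
Qed.

Lemma stateS t x : state t.+1 x = gate Q t.+1 *m (oracle R (qubits Q) x *m state t x).
Proof. by rewrite /state [run_op _ _ _.+1]/= !mulmxA. Qed.

Lemma ipS t x y : ip t.+1 x y = \sum_e amp t x (query_amp x e) * amp t y (query_amp y e).
Proof.
rewrite /ip !sum_E /amp; under eq_bigr do rewrite !enum_valK !stateS.
rewrite (gate_ip _ _ (gate_unitary Q t.+1)).
by apply: eq_bigr => p _; move: (state t x) (state t y) => u v; rewrite !oracleE.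
Qed.

Lemma amp_norm t x : (0 < N)%N -> \sum_e amp t x e ^+ 2 = 1.
Proof.
move=> N0; elim: t => [|t IHt].
  by rewrite -(ip0 x x N0); apply: eq_bigr => e _; rewrite expr2.
transitivity (ip t.+1 x x); first by apply: eq_bigr => e _; rewrite expr2.
rewrite ipS -IHt [RHS](reindex_inj (inv_inj (query_ampK x))) /=.
by apply: eq_bigr => e _; rewrite expr2.
Qed.

Lemma prob_outputE x b :
  prob_output Q x b = \sum_(e | rightmost e.1 == b) amp T x e ^+ 2.
Proof.
rewrite [RHS]big_mkcond sum_E.
rewrite /prob_output big_mkcond; apply: eq_bigr => p _.
by case: ifP => _; rewrite ?addr0 // /amp /= enum_valK.
Qed.

Lemma prob_output_compl x b : (0 < N)%N -> prob_output Q x (~~ b) = 1 - prob_output Q x b.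
Proof.
move=> N0; suff <- : prob_output Q x b + prob_output Q x (~~ b) = 1.
  by rewrite addrAC subrr add0r.
rewrite !prob_outputE -(amp_norm T x N0) [RHS](bigID (fun e : E => rightmost e.1 == b)) /=.
by congr (_ + _); apply: eq_bigl => e; case: (rightmost _); case: (b).
Qed.

Definition weight_at t x (i : 'I_N) : R := \sum_(e : E | e.1.1.1 == i) amp t x e ^+ 2.

Lemma weight_at_sum t x : (0 < N)%N -> \sum_i weight_at t x i = 1.
Proof. by move=> N0; rewrite -(amp_norm t x N0) (partition_big (fun e : E => e.1.1.1) predT). Qed.

(** The two inputs differ only in bit [i], so the composition of their oracles is an involution that
    moves only basis states with query index [i]. *)
Lemma ip_step t (c : R) x i : 0 < c ->
  ip t x (toggle i x) - ip t.+1 x (toggle i x)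
    <= c * weight_at t x i + c^-1 * weight_at t (toggle i x) i.
Proof.
move=> c0; set y := toggle i x.
pose sg (e : E) : E := query_amp y (query_amp x e).
have sgK : involutive sg.
  by move=> [[[j b] z] d]; rewrite /sg /query_amp /=; case: b (tnth x j) (tnth y j) => [] [] [].
have sgE e : e.1.1.1 != i -> sg e = e.
  case: e => [[[j b] z] d] /= ji; rewrite /sg /query_amp /=.
  by rewrite tnth_mktuple (negbTE ji) addbF addbK.
have -> : ip t.+1 x y = \sum_e amp t x e * amp t y (sg e).
  rewrite ipS (reindex_inj (inv_inj (query_ampK x))) /=.
  by apply: eq_bigr => e _; rewrite query_ampK.
apply: inner_sub_involution => // -[[[j b] z] d] //.
Qed.

Lemma adversary k : (k < N)%N ->
  (#|@edge N k|%:R - \sum_(p : X * 'I_N | edge k p) ip T p.1 (toggle p.2 p.1))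
    * Num.sqrt ((N - k) * k.+1)%:R <= 2 * T%:R * (#|@edge N k|%:R : R).
Proof.
move=> kN; have N0 : (0 < N)%N by apply: leq_ltn_trans kN.
set W := fun t => \sum_(p : X * 'I_N | edge k p) ip t p.1 (toggle p.2 p.1).
have a0 : (0 : R) < (N - k)%:R by rewrite ltr0n subn_gt0.
have b0 : (0 : R) < k.+1%:R by rewrite ltr0n.
set sa := Num.sqrt ((N - k)%:R : R); set sb := Num.sqrt (k.+1%:R : R).
have sa0 : 0 < sa by rewrite sqrtr_gt0.
have sb0 : 0 < sb by rewrite sqrtr_gt0.
have saE : sa ^+ 2 = (N - k)%:R by rewrite sqr_sqrtr ?ler0n.
have sbE : sb ^+ 2 = k.+1%:R by rewrite sqr_sqrtr ?ler0n.
have -> : Num.sqrt ((N - k) * k.+1)%:R = sa * sb by rewrite natrM sqrtrM ?ler0n.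
(* With this weight, each of the two terms of the bound on one query becomes the number of edges
   after multiplication by [sa * sb]. *)
pose c := sa / sb; have c0 : 0 < c by rewrite divr_gt0.
have step t : (W t - W t.+1) * (sa * sb) <= 2 * #|@edge N k|%:R.
  have le1 : W t - W t.+1 <= c * #|@slice N k|%:R + c^-1 * #|@slice N k.+1|%:R.
    rewrite /W -sumrB; apply: (@le_trans _ _ (\sum_(p : X * 'I_N | edge k p)
      (c * weight_at t p.1 p.2 + c^-1 * weight_at t (toggle p.2 p.1) p.2))).
      by apply: ler_sum => p _; exact: ip_step.
    apply: edge_sum_le; rewrite ?invr_ge0 ?(ltW c0) // => x.
      by move=> i; apply: sumr_ge0 => e _; exact: sqr_ge0.
    by rewrite weight_at_sum.
  have e1 : #|@edge N k|%:R = #|@slice N k|%:R * sa ^+ 2 :> R by rewrite card_edge natrM saE.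
  have e2 : #|@edge N k|%:R = #|@slice N k.+1|%:R * sb ^+ 2 :> R by rewrite card_edgeS natrM sbE.
  apply: (@le_trans _ _ ((c * #|@slice N k|%:R + c^-1 * #|@slice N k.+1|%:R) * (sa * sb))).
    by rewrite ler_pM2r // mulr_gt0.
  have -> : (c * #|@slice N k|%:R + c^-1 * #|@slice N k.+1|%:R) * (sa * sb)
      = #|@slice N k|%:R * sa ^+ 2 + #|@slice N k.+1|%:R * sb ^+ 2.
    by rewrite /c; field; rewrite !lt0r_neq0.
  rewrite -e1 -e2; lra.
have W0 : W 0%N = #|@edge N k|%:R.
  by rewrite -sum1_card natr_sum; apply: eq_bigr => p _; exact: ip0.
suff le_t t : (#|@edge N k|%:R - W t) * (sa * sb) <= 2 * t%:R * #|@edge N k|%:R by exact: le_t.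
elim: t => [|t IHt]; first by rewrite W0 subrr mul0r mulr0 mul0r.
have := step t; rewrite -natr1; lra.
Qed.

End Adversary.

Lemma eqbN (b c : bool) : (b == ~~ c) = (b != c).
Proof. by case: b; case: c. Qed.

Lemma inner_le_split (R : realFieldType) (E : finType) (P : pred E) (a b : E -> R) (c : R) :
  0 < c ->
  \sum_e a e * b e <=
    (c * \sum_(e | P e) a e ^+ 2 + c^-1 * \sum_(e | P e) b e ^+ 2) / 2
    + (c^-1 * \sum_(e | ~~ P e) a e ^+ 2 + c * \sum_(e | ~~ P e) b e ^+ 2) / 2.
Proof.
move=> c0; have ci0 : 0 < c^-1 by rewrite invr_gt0.
have sumle (S : pred E) (d : R) : 0 < d ->
    \sum_(e | S e) a e * b e <=
    (d * \sum_(e | S e) a e ^+ 2 + d^-1 * \sum_(e | S e) b e ^+ 2) / 2.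
  move=> d0; rewrite !mulr_sumr -big_split /= mulr_suml.
  by apply: ler_sum => e _; exact: amgm.
rewrite (bigID P) /=; apply: lerD; first exact: sumle.
by have := sumle (fun e => ~~ P e) c^-1 ci0; rewrite invrK.
Qed.

Section OutputIp.
Variables (R : realType) (N T : nat) (Q : qalg R N T).
Hypothesis N_gt0 : (0 < N)%N.
Local Notation X := (N.-tuple bool).
Implicit Types x y : X.

(** The inner product is split by the output bit and AM-GM is used with inverse weights on the two
    parts. If [x] favours [b] and [y] does not, a weight below 1 damps the large probabilities on
    both. *)
Lemma ip_le_prob x y b (c : R) : 0 < c ->
  ip Q T x y <= (c * prob_output Q x b + c^-1 * prob_output Q y b) / 2
    + (c^-1 * (1 - prob_output Q x b) + c * (1 - prob_output Q y b)) / 2.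
Proof.
move=> c0.
have probN z : 1 - prob_output Q z b =
    \sum_(e : basis N (qubits Q) * bool | rightmost e.1 != b) amp T z e ^+ 2.
  rewrite -(prob_output_compl Q z b N_gt0) prob_outputE.
  by apply: eq_bigl => e; rewrite eqbN.
move: (prob_outputE Q x b) (prob_outputE Q y b) (probN x) (probN y).
move: (prob_output Q x b) (prob_output Q y b) => p q Ep Eq -> ->; rewrite Ep Eq.
exact: inner_le_split.
Qed.

Lemma ip_le1 x y : ip Q T x y <= 1.
Proof.
have := ip_le_prob x y true ltr01.
move: (ip _ _ _ _) (prob_output Q x true) (prob_output Q y true) => g p q.
by rewrite invr1; lra.
Qed.

Lemma ip_bounded_error x y b : 2 / 3 <= prob_output Q x b ->
  2 / 3 <= prob_output Q y (~~ b) -> ip Q T x y <= 1 - 1 / 18.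
Proof.
(* In the extreme case of probabilities 2/3 and 1/3, each part is at most
   [(3/4 * 2/3 + 4/3 * 1/3) / 2 = 17/36]. *)
have c0 : (0 : R) < 3 / 4 by lra.
have ci : (3 / 4)^-1 = 4 / 3 :> R by rewrite invf_div.
have := ip_le_prob x y b c0; rewrite (prob_output_compl Q y b N_gt0) ci.
move: (ip _ _ _ _) (prob_output Q x b) (prob_output Q y b) => g p q; lra.
Qed.

Lemma ip_exact x y b : prob_output Q x b = 1 -> prob_output Q y b = 0 -> ip Q T x y <= 0.
Proof.
move=> xb yb; rewrite leNgt; apply/negP => ip0.
(* For exact answers the bound of [ip_le_prob] is [c] itself, so half the inner product gives a
   contradiction. *)
have c0 : 0 < ip Q T x y / 2 by rewrite divr_gt0.
have := ip_le_prob x y b c0; move: ip0; rewrite xb yb {xb yb c0}.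
by move: (ip _ _ _ _) => g; lra.
Qed.

End OutputIp.

(** * Lower bounds from a jump between adjacent weights *)

Section LowerBound.
Variables (R : realType) (N : nat) (f : N.-tuple bool -> bool) (k : nat).
Local Notation X := (N.-tuple bool).
Hypothesis kN : (k < N)%N.
Hypothesis f_edge : forall p, edge k p -> f p.1 != f (toggle p.2 p.1).

Let N_gt0 : (0 < N)%N := leq_ltn_trans (leq0n k) kN.

Lemma hamming_prefix j : (j <= N)%N -> hamming [tuple (i < j)%N | i < N] = j.
Proof.
move=> jN; rewrite hammingE; under eq_bigr do rewrite tnth_mktuple.
by rewrite -(big_mkord xpredT (fun i => nat_of_bool (i < j)%N)) (big_cat_nat _ jN) //=
  big_nat (eq_bigr (fun=> 1%N)) => [|i /andP[_ ->]] //; rewrite -big_nat sum_nat_const_nat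
  subn0 muln1 big_nat big1 ?addn0 // => i /andP[]; rewrite leqNgt => /negbTE->.
Qed.

Lemma edge_gt0 : (0 < #|@edge N k|)%N.
Proof.
apply/card_gt0P; exists ([tuple (i < k)%N | i < N], Ordinal kN).
by rewrite unfold_in /edge /= hamming_prefix ?eqxx ?tnth_mktuple ?ltnn // ltnW.
Qed.

Lemma query_lb (d : R) T (Q : qalg R N T) :
  \sum_(p : X * 'I_N | edge k p) ip Q T p.1 (toggle p.2 p.1) <= (1 - d) * #|@edge N k|%:R ->
  d * Num.sqrt ((N - k) * k.+1)%:R <= 2 * T%:R.
Proof.
have E0 : (0 : R) < #|@edge N k|%:R by rewrite ltr0n edge_gt0.
move=> le_d; rewrite -(ler_pM2r E0); apply: le_trans (adversary Q kN).
rewrite mulrAC ler_wpM2r ?sqrtr_ge0 //; lra.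
Qed.

Lemma bounded_error_lb T (Q : qalg R N T) : bounded_error Q f ->
  Num.sqrt ((N - k) * k.+1)%:R <= 36 * T%:R :> R.
Proof.
move=> beQ; suff : 1 / 18 * Num.sqrt ((N - k) * k.+1)%:R <= 2 * T%:R :> R by lra.
apply: query_lb; rewrite mulr_natr -sumr_const.
apply: ler_sum => p ep; apply: (ip_bounded_error N_gt0 (beQ p.1)).
by have := f_edge ep; case: (f p.1) (beQ (toggle p.2 p.1)); case: (f _).
Qed.

Definition edge_distribution (x : X) : R :=
  (2 * #|@edge N k|%:R)^-1 *
    \sum_(p : X * 'I_N | edge k p) ((p.1 == x)%:R + (toggle p.2 p.1 == x)%:R).

Lemma sum_edge_distribution (P : pred X) :
  \sum_(x | P x) edge_distribution x = (2 * #|@edge N k|%:R)^-1 *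
    \sum_(p : X * 'I_N | edge k p) ((P p.1)%:R + (P (toggle p.2 p.1))%:R).
Proof.
rewrite -mulr_sumr exchange_big /=; congr (_ * _); apply: eq_bigr => p _.
have sum1 a : \sum_(x | P x) (a == x)%:R = (P a)%:R :> R.
  rewrite big_mkcond (bigD1 a) //= eqxx big1 ?addr0 => [|x xa]; first by case: (P a).
  by rewrite eq_sym (negbTE xa); case: (P x).
by rewrite big_split /= !sum1.
Qed.

Lemma edge_distributionP : is_distribution edge_distribution.
Proof.
have E0 : (0 : R) < #|@edge N k|%:R by rewrite ltr0n edge_gt0.
split=> [x|].
  by rewrite mulr_ge0 ?invr_ge0 ?mulr_ge0 // sumr_ge0 // => p _; rewrite addr_ge0.
rewrite (sum_edge_distribution xpredT) sumr_const -[X in _ * X]mulr_natr /=.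
have -> : (1 + 1 : R) = 2 by [].
by rewrite mulVf // mulf_neq0 ?lt0r_neq0.
Qed.

Lemma weakly_exact_lb T (Q : qalg R N T) : weakly_exact Q edge_distribution f ->
  Num.sqrt ((N - k) * k.+1)%:R <= 36 * T%:R :> R.
Proof.
have E0 : (0 : R) < #|@edge N k|%:R by rewrite ltr0n edge_gt0.
set good := fun x => accept_prob Q x == (f x)%:R.
have goodP x : good x -> prob_output Q x (f x) = 1.
  move=> /eqP; rewrite /accept_prob; case: (f x) => // h.
  by rewrite (prob_output_compl Q x true N_gt0) h subr0.
rewrite /weakly_exact (sum_edge_distribution good) -ler_pdivrMl ?invr_gt0 ?mulr_gt0 // invrK => we.
suff : 1 / 3 * Num.sqrt ((N - k) * k.+1)%:R <= 2 * T%:R :> R.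
  by have := sqrtr_ge0 (((N - k) * k.+1)%:R : R); lra.
apply: query_lb.
(* An edge with two good ends has inner product at most 0, any other at most 1. As at least 2/3 of
   the [2 E] ends are good, the total is at most [2 E - 4/3 E]. *)
apply: (@le_trans _ _ (\sum_(p : X * 'I_N | edge k p)
  (2 - ((good p.1)%:R + (good (toggle p.2 p.1))%:R)))).
  apply: ler_sum => p ep; have le1 := ip_le1 Q N_gt0 p.1 (toggle p.2 p.1).
  have := f_edge ep; set y := toggle _ _ in le1 *.
  case gx: (good p.1); case gy: (good y) => /= fxy; try lra.
  have yb : prob_output Q y (f p.1) = 0.
    have -> : f p.1 = ~~ f y by move: fxy; case: (f _); case: (f _).
    by rewrite prob_output_compl // goodP // subrr.
  by have := ip_exact N_gt0 (goodP _ gx) yb; lra.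
rewrite sumrB sumr_const -[X in X - _]mulr_natr; lra.
Qed.

End LowerBound.

(** * Symmetric functions *)

Lemma big_minn_le (I : finType) (P : pred I) (F : I -> nat) n i :
  P i -> (\big[minn/n]_(j | P j) F j <= F i)%N.
Proof.
move=> Pi; have := mem_index_enum i; elim: (index_enum I) => [//|j s IHs].
rewrite inE big_cons => /predU1P[<-|/IHs le_s]; first by rewrite Pi geq_minl.
by case: (P j) => //; apply: leq_trans (geq_minr _ _) le_s.
Qed.

Lemma big_minn_eq (I : finType) (P : pred I) (F : I -> nat) n i :
  P i -> (forall j, P j -> F j <= n)%N ->
  exists2 j, P j & \big[minn/n]_(j | P j) F j = F j.
Proof.
move=> Pi Fn.
have [[j Pj ->]|En] : (exists2 j, P j & \big[minn/n]_(j | P j) F j = F j) \/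
    \big[minn/n]_(j | P j) F j = n.
- apply: (big_ind (fun m => (exists2 j, P j & m = F j) \/ m = n)); first by right.
    by move=> a b Ha Hb; rewrite /minn; case: ifP.
  by move=> j Pj; left; exists j.
- by exists j.
- exists i => //; apply/eqP; rewrite eqn_leq big_minn_le //= En; exact: Fn.
Qed.

Section SymmetricFun.
Variables (N : nat) (f : N.-tuple bool -> bool).
Local Notation X := (N.-tuple bool).
Hypothesis f_sym : symmetric_fun f.

Lemma hamming_le (x : X) : (hamming x <= N)%N.
Proof. by rewrite -[leqRHS](size_tuple x) count_size. Qed.

Lemma sym_weight x : f x = weight_value f (hamming x).
Proof. by apply: f_sym; rewrite hamming_prefix // hamming_le. Qed.

Lemma card_ones (x : X) : #|ones setT x| = hamming x.
Proof.
by rewrite hammingE -sum1_card big_mkcond; apply: eq_bigr => i _; rewrite !inE; case: (tnth x i).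
Qed.

Lemma hamming_flip (x : X) : (hamming (flip x) + hamming x = N)%N.
Proof.
rewrite -!card_ones -[RHS](card_ord N) -(cardsC (ones setT x)) addnC; congr (_ + _)%N.
by apply: eq_card => i; rewrite !inE tnth_mktuple.
Qed.

Lemma jump_exists : non_constant f ->
  exists k : 'I_N, weight_value f k != weight_value f k.+1.
Proof.
move=> [x [y fxy]]; apply/existsP; apply: contra_notT fxy => /existsPn nojump.
suff const j : (j <= N)%N -> weight_value f j = weight_value f 0.
  by rewrite !sym_weight !const ?hamming_le.
elim: j => [//|j IHj] jN; rewrite -(IHj (ltnW jN)).
by have := nojump (Ordinal jN); rewrite negbK => /eqP.
Qed.

(** A jump at [t] with [K <= t < N - K] would have [|2 t - N + 1| <= N - 2 K - 1], which is less
    than [Gamma f]. *)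
Lemma weight_value_const K : (Gamma f + 2 * K = N.+1)%N ->
  forall t, (K <= t <= N - K)%N -> weight_value f t = weight_value f K.
Proof.
move=> GK t /andP[Kt tN].
suff const j : (K + j <= N - K)%N -> weight_value f (K + j) = weight_value f K.
  by rewrite -(subnKC Kt) const // subnKC.
elim: j => [|j IHj] jN; first by rewrite addn0.
rewrite -IHj; last by apply: leq_trans jN; rewrite leq_add2l.
have jlt : (K + j < N)%N by lia.
apply/eqP/negPn/negP => jump.
have := @big_minn_le _ (fun k : 'I_N => weight_value f k != weight_value f k.+1)
  (fun k : 'I_N => absz ((2 * k)%:Z - N%:Z + 1)) N (Ordinal jlt).
rewrite /= -addnS eq_sym jump -/(Gamma f) => /(_ isT).
by move: (Gamma f) GK => G GK le_G; lia.
Qed.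

End SymmetricFun.

(** At a minimizing [k], [Gamma f] is the distance between [k + 1] and [N - k]. Adding twice the
    smaller of the two gives their sum [N + 1]. *)
Lemma Gamma_jump N (f : N.-tuple bool -> bool) :
  symmetric_fun f -> non_constant f ->
  exists k : 'I_N, exists K, [/\ weight_value f k != weight_value f k.+1,
    (Gamma f + 2 * K = N.+1)%N & K = minn k.+1 (N - k)].
Proof.
move=> fs fn; have [i ji] := jump_exists fs fn.
have [|j jj E] := @big_minn_eq _ (fun k : 'I_N => weight_value f k != weight_value f k.+1)
  (fun k : 'I_N => absz ((2 * k)%:Z - N%:Z + 1)) N i ji.
  by move=> k _; have := ltn_ord k; lia.
exists j, (minn j.+1 (N - j)); split=> //.
by rewrite /Gamma E; have := ltn_ord j; lia.
Qed.

(** * A seeded algorithm for symmetric functions *)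

Section Upper.
Variables (R : realType) (N : nat) (f : N.-tuple bool -> bool) (K : nat).
Local Notation X := (N.-tuple bool).
Hypothesis f_sym : symmetric_fun f.
Hypothesis K_gt0 : (0 < K)%N.
Hypothesis K_Gamma : (Gamma f + 2 * K = N.+1)%N.

Definition count_time : nat := \sum_(l < N.+1) identify_time R (N %/ 2 ^ l) (74 * K).

(** Nothing is asked when [hamming x < K], since the full set at level 0 then yields the exact
    count. *)
Definition good_sample (s : {perm 'I_N}) (x : X) : bool :=
  (K <= hamming x)%N ==> [exists l : 'I_N.+1,
    (K <= #|ones setT x :&: sample s (N %/ 2 ^ l)| <= 74 * K)%N].

Lemma ones_sample (s : {perm 'I_N}) n (x : X) : ones (sample s n) x = ones setT x :&: sample s n.
Proof. by apply/setP => i; rewrite !inE andbC. Qed.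

Lemma outputs_count s : outputs R count_time (fun (x : X) (c : 'I_N.+1) =>
  [/\ (c <= hamming x)%N, (hamming x < K)%N -> c = hamming x :> nat
    & good_sample s x -> (K <= hamming x)%N -> (K <= c)%N]).
Proof.
have Sn l : #|sample s (N %/ 2 ^ l)| = (N %/ 2 ^ l)%N by rewrite card_sample ?leq_div.
apply: (outputs_map (g := fun F : {set 'I_N} => inord #|F|) (identify_all R (74 * K) N.+1 Sn)).
move=> x F [FA FS]; have cF : (#|F| <= hamming x)%N by rewrite -card_ones subset_leq_card.
rewrite inordK ?ltnS ?(leq_trans cF) ?hamming_le //; split=> // [ltK|gx leK].
  apply/eqP; rewrite eqn_leq cF /= -card_ones subset_leq_card //.
  have := FS 0%N isT; rewrite ones_sample expn0 divn1.
  have -> : sample s N = setT by apply/setP => i; rewrite !inE ltn_ord.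
  by rewrite setIT; apply; rewrite card_ones (leq_trans (ltnW ltK)) // leq_pmull.
move: gx; rewrite /good_sample leK => /existsP[l /andP[lb ub]].
by apply: (leq_trans lb); rewrite subset_leq_card // -ones_sample FS // ones_sample.
Qed.

Definition good_seed s x := good_sample s x && good_sample s (flip x).

Lemma outputs_f s : outputs R (count_time + count_time) (fun (x : X) b =>
  good_seed s x -> b = f x).
Proof.
(* [c1] counts ones and [c2] zeros. A count below [K] is exact and determines the weight; if neither
   is below [K], the weight lies in [[K, N - K]], where [f] takes its value at [K]. *)
apply: (outputs_bind (g := fun c1 c2 : 'I_N.+1 =>
   weight_value f (if K <= c1 then if K <= c2 then K else N - c2 else c1)%N)
   (outputs_count s) (fun=> outputs_flip (outputs_count s))).
move=> x c1 c2 [le1 eq1 ge1] [le2 eq2 ge2] /andP[/ge1{}ge1 /ge2{}ge2].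
rewrite (sym_weight f_sym x); have hf := hamming_flip x.
have [ltK|leK] := ltnP (hamming x) K; first by rewrite leqNgt eq1 // ltK.
rewrite ge1 //; have [ltK'|leK'] := ltnP (hamming (flip x)) K.
  rewrite leqNgt eq2 // ltK' /=; congr weight_value.
  by move: (eq2 ltK') => E2; lia.
rewrite ge2 //; symmetry; apply: weight_value_const => //; lia.
Qed.

(** Each of [x] and its complement spoils at most 1/6 of the seeds. *)
Lemma card_good_seed x : (2 * #|{perm 'I_N}| <= 3 * #|[set s | good_seed s x]|)%N.
Proof.
clear f_sym K_Gamma; have most y : (5 * #|{perm 'I_N}| <= 6 * #|[set s | good_sample s y]|)%N.
  have [ltK|leK] := ltnP (hamming y) K.
    rewrite (_ : [set s | _] = setT) ?cardsT ?leq_mul //.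
    by apply/setP => s; rewrite !inE /good_sample leqNgt ltK.
  have [|l lN le5] := sampling R K_gt0 (_ : K <= #|ones setT y|)%N; first by rewrite card_ones.
  apply: (leq_trans le5); rewrite leq_mul2l subset_leq_card //.
  apply/subsetP => s; rewrite !inE /good_sample leK => bnd.
  by apply/existsP; exists (Ordinal lN).
have := most x; have := most (flip x).
set A := [set s | good_sample s (flip x)]; set B := [set s | good_sample s x].
have -> : [set s | good_seed s x] = B :&: A by apply/setP => s; rewrite !inE.
have := cardsUI B A; have := max_card (mem (B :|: A)).
by move: #|_ :|: _| #|_ :&: _| #|A| #|B| #|{perm 'I_N}| => a b c d e; lia.
Qed.

Lemma count_time_le : count_time%:R <= 144 * Num.sqrt (N%:R * K%:R) :> R.
Proof.
rewrite /count_time natr_sum.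
(* The factor 36 is [4 * 9] with [74 <= 9^2], and [1/2 <= (3/4)^2] gives a rational ratio. The
   geometric series then contributes the factor 4 in 144. *)
have term l : (identify_time R (N %/ 2 ^ l) (74 * K))%:R <=
    36 * Num.sqrt (N%:R * K%:R) * (3 / 4) ^+ l :> R.
  apply: (le_trans (identify_time_le R _ _)).
  have -> : 36 * Num.sqrt (N%:R * K%:R) * (3 / 4) ^+ l =
      4 * (9 * (3 / 4) ^+ l * Num.sqrt (N%:R * K%:R)) :> R by ring.
  rewrite ler_pM2l //.
  have p0 : (0 : R) <= 9 * (3 / 4) ^+ l by rewrite mulr_ge0 // exprn_ge0 // divr_ge0.
  rewrite -(ger0_norm p0) -sqrtr_sqr -sqrtrM ?sqr_ge0 // ler_wsqrtr // exprMn -exprM (mulnC l) exprM.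
  rewrite natrM (natrM _ 74 K).
  have le_n : (N %/ 2 ^ l)%:R <= N%:R * ((3 / 4) ^+ 2) ^+ l :> R.
    have : (N %/ 2 ^ l)%:R <= N%:R * (1 / 2) ^+ l :> R.
      rewrite expr_div_n expr1n mul1r ler_pdivlMr ?exprn_gt0 // -natrX -natrM ler_nat.
      exact: leq_trunc_div.
    move/le_trans; apply; apply: ler_wpM2l => //; apply: lerXn2r; rewrite ?nnegrE; lra.
  have q0 : (0 : R) <= ((3 / 4) ^+ 2) ^+ l by rewrite exprn_ge0 // sqr_ge0.
  have K0 : (0 : R) <= K%:R by [].
  have N0 : (0 : R) <= N%:R by [].
  have : (N %/ 2 ^ l)%:R * K%:R <= N%:R * ((3 / 4) ^+ 2) ^+ l * K%:R :> R by rewrite ler_wpM2r.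
  have : 0 <= N%:R * ((3 / 4) ^+ 2) ^+ l * K%:R :> R by rewrite !mulr_ge0.
  move: (((3 / 4) ^+ 2) ^+ l) => r; lra.
apply: (@le_trans _ _ (\sum_(l < N.+1) 36 * Num.sqrt (N%:R * K%:R) * (3 / 4) ^+ l)).
  by apply: ler_sum => l _; exact: term.
rewrite -mulr_sumr; have s0 := sqrtr_ge0 (N%:R * K%:R : R).
have : \sum_(l < N.+1) (3 / 4) ^+ l <= 4 :> R.
  have := subrX1 (3 / 4 : R) N.+1.
  have : (0 : R) <= (3 / 4) ^+ N.+1 by rewrite exprn_ge0 // divr_ge0.
  lra.
nra.
Qed.

End Upper.

Lemma is_min_exists (P : nat -> Prop) n : P n -> exists2 m, is_min P m & (m <= n)%N.
Proof.
move=> Pn; have exP : exists m, `[< P m >] by exists n; apply/asboolP.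
exists (ex_minn exP); case: ex_minnP => m /asboolP Pm min_m; last by apply: min_m; apply/asboolP.
by split=> // k Pk; apply: min_m; apply/asboolP.
Qed.

(** * Upper bounds for both complexities *)

Section Theta.
Variables (R : realType) (N : nat) (f : N.-tuple bool -> bool) (K : nat).
Local Notation X := (N.-tuple bool).
Hypothesis N_gt0 : (0 < N)%N.
Hypothesis f_sym : symmetric_fun f.
Hypothesis K_gt0 : (0 < K)%N.
Hypothesis K_Gamma : (Gamma f + 2 * K = N.+1)%N.

Local Notation T := (count_time R N K + count_time R N K)%N.

(* The same seeded family of exact algorithms yields the bounded-error algorithm
   (run the uniform mixture) and, for each distribution, a weakly exact one (fix
   the best seed). *)
Lemma seeded_exact : exists A : {perm 'I_N} -> bool -> X -> X -> R,
  [/\ forall s b, psd (A s b), forall s, reach T (fun x y => \sum_b A s b x y)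
    & forall s x, good_seed K s x -> forall b, A s b x x = (b == f x)%:R].
Proof.
have /fin_all_exists[A AP] := outputs_f R f_sym K_gt0 K_Gamma.
exists A; split=> [s|s|s x gs b]; case: (AP s) => // _ rA fA.
(* The wrong answer has probability 0, and the two probabilities add up to 1. *)
have nf : A s (~~ f x) x x = 0.
  by apply: contraPeq (gs) => /fA h /h; case: (f x).
have := reach_diag x rA; rewrite big_bool; case: b => /=.
all: by move: nf; case: (f x) => /= -> //; rewrite ?addr0 ?add0r.
Qed.

Lemma good_seed_mean (x : X) :
  2 / 3 * #|{perm 'I_N}|%:R <= \sum_(s : {perm 'I_N} | good_seed K s x) 1 :> R.
Proof.
rewrite sumr_const; have := card_good_seed R K_gt0 x; rewrite cardsE -(ler_nat R) !natrM; lra.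
Qed.

Lemma bounded_error_ub : exists A : qalg R N T, bounded_error A f.
Proof.
have [A [pA rA gA]] := seeded_exact.
set M : R := #|{perm 'I_N}|%:R.
have M0 : 0 < M by rewrite ltr0n; apply/card_gt0P; exists 1%g.
(* A register holding a uniformly distributed seed is prepared without queries and controls the
   algorithm. *)
have pM (s : {perm 'I_N}) : psd (fun _ _ : X => M^-1).
  by apply: psd_const; rewrite invr_ge0 ltW.
have rM : reach 0 (fun _ _ : X => \sum_(s : {perm 'I_N}) M^-1).
  by move=> x y /=; rewrite sumr_const -[LHS]mulr_natr mulVf ?lt0r_neq0.
have := reach_control pM rM rA; rewrite addn0 => rMA.
have [] := @reach_qalg R N N_gt0 T (fun b x y => \sum_s M^-1 * A s b x y).
- by move=> b; apply: (psd_sum _ (A := fun s x y => M^-1 * A s b x y)) => s;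
  exact: psdM (pM s) (pA s b).
- apply: eq_reach rMA => x y; rewrite exchange_big /=.
  by apply: eq_bigr => s _; rewrite mulr_sumr.
move=> Q QE; exists Q => x; rewrite QE -mulr_sumr [leRHS]mulrC ler_pdivlMr //.
apply: le_trans (good_seed_mean x) _; rewrite [leRHS](bigID (fun s => good_seed K s x)) /=.
rewrite -[leLHS]addr0; apply: lerD; last by apply: sumr_ge0 => s _; exact: psd_diag.
by apply: ler_sum => s gs; rewrite (gA s x gs) eqxx.
Qed.

Lemma weakly_exact_ub mu : is_distribution mu -> exists A : qalg R N T, weakly_exact A mu f.
Proof.
move=> [mu0 mu1]; have [A [pA rA gA]] := seeded_exact.
(* Averaging: exchanging the sums over seeds and inputs shows that the mean over [s] of the good
   mass is at least 2/3. *)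
have [s le_s] : exists s : {perm 'I_N}, 2 / 3 <= \sum_(x | good_seed K s x) mu x.
  apply/not_existsP => lt_s.
  have : \sum_(s : {perm 'I_N}) \sum_(x | good_seed K s x) mu x < \sum_(s : {perm 'I_N}) 2 / 3.
    apply: ltr_sum => [|s _]; first by apply/hasP; exists 1%g; rewrite ?mem_index_enum.
    by rewrite ltNge; apply/negP/lt_s.
  apply/negP; rewrite -leNgt sumr_const -[leLHS]mulr_natr.
  have -> : 2 / 3 * #|{: {perm 'I_N}}|%:R = \sum_x 2 / 3 * #|{perm 'I_N}|%:R * mu x.
    by rewrite -mulr_sumr mu1 mulr1.
  rewrite (exchange_big_dep xpredT) //=.
  apply: ler_sum => x _; under [leRHS]eq_bigr do rewrite -[mu x]mul1r.
  by rewrite -mulr_suml; apply: ler_wpM2r => //; exact: good_seed_mean.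
have [Q QE] := reach_qalg N_gt0 (pA s) (rA s).
exists Q; apply: (le_trans le_s); rewrite /accept_prob.
rewrite [leRHS]big_mkcond [leLHS]big_mkcond; apply: ler_sum => x _.
case: ifP => [gs|_]; last by case: ifP.
by rewrite QE (gA s x gs); case: (f x); rewrite /= eqxx.
Qed.

End Theta.

Theorem theorem3 (R : realType) :
  exists c C : R, [/\ 0 < c, 0 < C &
    forall (N : nat) (f : N.-tuple bool -> bool),
      symmetric_fun f -> non_constant f ->
      exists q w : nat,
        [/\ is_Q2 R f q,
            is_max_QWE R f w,
            within c C (q%:R : R) (w%:R : R) &
            within c C (w%:R : R)
              (Num.sqrt (N%:R * (N%:R - (Gamma f)%:R)) : R)]].
Proof.
(* Both complexities are at most [288 S] and at least [S / 72], and [288 * 72 = 20736]. *)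
exists 20736^-1, 20736; split=> [||N f fs fn]; rewrite ?invr_gt0 //.
have [k [K [jk GK KE]]] := Gamma_jump fs fn.
have kN := ltn_ord k; have N0 : (0 < N)%N by lia.
have K0 : (0 < K)%N by rewrite KE; lia.
set S : R := Num.sqrt _; pose T := (count_time R N K + count_time R N K)%N.
have S0 : 0 <= S := sqrtr_ge0 _.
have GE : N%:R - (Gamma f)%:R = (2 * K)%:R - 1 :> R.
  have := congr1 (fun n => n%:R : R) GK; rewrite natrD -natr1; lra.
have K1 : (1 : R) <= K%:R by rewrite ler1n.
have N1 : (0 : R) <= N%:R by [].
have ubT : T%:R <= 288 * S.
  have le_S : Num.sqrt (N%:R * K%:R) <= S :> R.
    by rewrite /S ler_wsqrtr // ler_wpM2l // GE natrM; lra.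
  have := count_time_le R N K; rewrite /T natrD; lra.
(* The factors [k + 1] and [N - k] are [K] and [N + 1 - K], and the larger is at least
   [(N + 1) / 2]. Hence [N (2 K - 1) <= 4 (N - k) (k + 1)]. *)
have lbS : S <= 2 * Num.sqrt ((N - k) * k.+1)%:R.
  have two : (2 : R) = Num.sqrt (2 ^+ 2) by rewrite sqrtr_sqr ger0_norm.
  rewrite {1}two -sqrtrM ?sqr_ge0 // /S ler_wsqrtr // GE.
  have -> : (2 * K)%:R - 1 = (2 * K - 1)%:R :> R by rewrite natrB //; lia.
  rewrite -natrX -!natrM ler_nat KE; move: (k : nat) kN => j jN.
  have [ab|ab] := leqP j.+1 (N - j); nia.
have edgef p : edge k p -> f p.1 != f (toggle p.2 p.1).
  move=> /andP[/eqP hp np]; rewrite !(sym_weight fs) hamming_toggle // hp; exact: jk.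
have [q q_min qT] : exists2 q, is_Q2 R f q & (q <= T)%N.
  apply: (is_min_exists (P := fun t => exists A : qalg R N t, bounded_error A f)).
  exact: bounded_error_ub.
have QWE (mu : N.-tuple bool -> R) : is_distribution mu ->
    exists2 q, is_QWE mu f q & (q <= T)%N.
  move=> mu_dist.
  apply: (is_min_exists (P := fun t => exists A : qalg R N t, weakly_exact A mu f)).
  exact: weakly_exact_ub.
have mu_dist := edge_distributionP R kN; set mu := edge_distribution R _ in mu_dist.
have [w0 w0_min w0T] := QWE _ mu_dist.
(* The attained values of the weakly exact complexity form a nonempty set bounded by [T], so a
   maximum exists. *)
pose W w := `[< exists2 mu : N.-tuple bool -> R, is_distribution mu & is_QWE mu f w >].
have W0 : exists w, W w by exists w0; apply/asboolP; exists mu.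
have WT w : W w -> (w <= T)%N.
  move=> /asboolP[nu nu_dist [_ w_min]]; have [v [vP _] vT] := QWE nu nu_dist.
  exact: leq_trans (w_min v vP) vT.
have [w Ww w_max] := ex_maxnP W0 WT.
have q_lb : Num.sqrt ((N - k) * k.+1)%:R <= 36 * q%:R :> R.
  by case: q_min => -[A beA] _; exact: (bounded_error_lb kN edgef beA).
have w_lb : Num.sqrt ((N - k) * k.+1)%:R <= 36 * w%:R :> R.
  apply: (@le_trans _ _ (36 * w0%:R)).
    by case: w0_min => -[A weA] _; exact: (weakly_exact_lb kN edgef weA).
  rewrite ler_pM2l // ler_nat; apply: w_max; apply/asboolP; by exists mu.
have q_ub : q%:R <= T%:R :> R by rewrite ler_nat.
have w_ub : w%:R <= T%:R :> R by rewrite ler_nat WT.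
exists q, w; split=> //; last 2 first.
- by rewrite /within; apply/andP; split; lra.
- by rewrite /within; apply/andP; split; lra.
split; first by move/asboolP: Ww.
move=> nu nu_dist; have [v v_min _] := QWE nu nu_dist; exists v => //.
by apply: w_max; apply/asboolP; exists nu.
Qed.
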